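(* Let $\mathcal{C} = \{C_{1}, \ldots, C_{k}\} \subset \mathbb{P}^{2}_{\mathbb{C}}$ be an arrangement of $k\geq 2$ smooth conics whose only singularities are $n_{2}$ nodes and $n_{3}$ ordinary triple points. Then the curve $\mathcal{C} : f = 0$ (where $f = \prod_{i} f_i$ is the product of the defining quadratic forms, a reduced curve of degree $d=2k$) is never nearly free.
   Context: Let $S=\mathbb{C}[x,y,z]$ and for a homogeneous reduced $f\in S$ of degree $d$ let $J_f=(\partial_x f,\partial_y f,\partial_z f)$ be the Jacobian ideal and $M(f)=S/J_f$ the Milnor algebra. The curve $C: f=0$ is called $m$-syzygy if $M(f)$ has a minimal graded free resolution of the form $0 \to \bigoplus_{i=1}^{m-2} S(-e_i) \to \bigoplus_{i=1}^{m} S(1-d-d_i) \to S^3(1-d) \to S$ with $e_1\le \dots\le e_{m-2}$ and $1\le d_1\le \dots \le d_m$. The curve $C$ is nearly free if it is $3$-syzygy with $d_1+d_2=d$, $d_2=d_3$ and $e_1=d+d_2$. An ordinary triple point is a point where three smooth branches meet with pairwise distinct tangents. *)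

(* Defs.v *)
From HB Require Import structures.
From mathcomp Require Import all_boot all_algebra.
From mathcomp Require Import reals.
From mathcomp.real_closed Require Import complex.
From mathcomp Require Import mpoly.
Set Implicit Arguments. Unset Strict Implicit. Unset Printing Implicit Defensive.
Import GRing.Theory.
Local Open Scope ring_scope.

Section MilnorAlgebra.
Variable F : fieldType.
Local Notation S := {mpoly F[3]}.

Definition grad (f : S) : 'rV[S]_3 := \row_j mderiv j f.

(* an entry of a degree-0 graded map S(-n) -> S(-m) which moreover lies in
   the irrelevant maximal ideal (minimality): homogeneous of degree n - m > 0,
   or zero *)
Definition min_graded_entry (n m : nat) (p : S) : bool :=
  if (m < n)%N then p \is (n - m).-homog else p == 0.

(* M(f) = S/J_f has a minimal graded free resolution
   0 -> (+)_{j<m-2} S(-e_j) --B--> (+)_{i<m} S(1-d-d_i) --A--> S^3(1-d)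
     --grad f--> S
   with 1 <= d_0 <= ... <= d_{m-1} and e_0 <= ... <= e_{m-3}. *)
Definition msyzygy_resolution (f : S) (d m : nat)
    (ds : 'I_m -> nat) (es : 'I_(m - 2) -> nat) : Prop :=
  exists (A : 'M[S]_(3, m)) (B : 'M[S]_(m, m - 2)),
  [/\ [/\ (forall i : 'I_m, 1 <= ds i)%N,
          (forall i j : 'I_m, (i <= j)%N -> (ds i <= ds j)%N),
          (forall i j : 'I_(m - 2), (i <= j)%N -> (es i <= es j)%N),
          (forall (r : 'I_3) (i : 'I_m), A r i \is (ds i).-homog) &
          (forall (i : 'I_m) (j : 'I_(m - 2)),
            min_graded_entry (es j) (d - 1 + ds i) (B i j))] &
      [/\ grad f *m A = 0,
          (forall u : 'cV[S]_3, grad f *m u = 0 ->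
              exists w : 'cV[S]_m, u = A *m w),
          A *m B = 0,
          (forall w : 'cV[S]_m, A *m w = 0 ->
              exists z : 'cV[S]_(m - 2), w = B *m z) &
          (forall z : 'cV[S]_(m - 2), B *m z = 0 -> z = 0)]].

Definition msyzygy (f : S) (m : nat) (d : nat)
    (ds : 'I_m -> nat) (es : 'I_(m - 2) -> nat) : Prop :=
  [/\ f != 0, f \is d.-homog & msyzygy_resolution f d ds es].

Definition nearly_free (f : S) : Prop :=
  exists (d : nat) (ds : 'I_3 -> nat) (es : 'I_(3 - 2) -> nat),
    [/\ msyzygy f d ds es,
        ds (@Ordinal 3 0 isT) + ds (@Ordinal 3 1 isT) = d,
        ds (@Ordinal 3 1 isT) = ds (@Ordinal 3 2 isT) &
        es (@Ordinal (3 - 2) 0 isT) = d + ds (@Ordinal 3 1 isT)]%N.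

(* projective points are represented by nonzero vectors of F^3 *)
Definition nonzero_vec (v : 'I_3 -> F) : Prop := exists j, v j != 0.

(* singular point of the curve f = 0 (all partials vanish; by Euler f too) *)
Definition singular_point (f : S) (v : 'I_3 -> F) : Prop :=
  nonzero_vec v /\ forall j : 'I_3, (mderiv j f).@[v] = 0.

Definition smooth_curve (f : S) : Prop :=
  forall v : 'I_3 -> F, nonzero_vec v -> f.@[v] = 0 ->
    exists j : 'I_3, (mderiv j f).@[v] != 0.

Section Arrangement.
Variables (k : nat) (q : 'I_k -> S).

Definition through (v : 'I_3 -> F) : {set 'I_k} := [set i | (q i).@[v] == 0].

(* the (smooth) branches q i, q j through v have distinct tangent lines:
   their gradients at v are not proportional *)
Definition distinct_tangents (v : 'I_3 -> F) : Prop :=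
  forall i j : 'I_k, i != j -> i \in through v -> j \in through v ->
    ~ (exists c : F, forall l : 'I_3,
         (mderiv l (q i)).@[v] = c * (mderiv l (q j)).@[v]).

Definition node_at (v : 'I_3 -> F) : Prop :=
  #|through v| = 2%N /\ distinct_tangents v.

Definition ordinary_triple_at (v : 'I_3 -> F) : Prop :=
  #|through v| = 3%N /\ distinct_tangents v.
End Arrangement.

End MilnorAlgebra.

(* Main.v *)
Require Import Defs.
From HB Require Import structures.
From mathcomp Require Import all_boot all_algebra.
From mathcomp Require Import reals.
From mathcomp.real_closed Require Import complex.
From mathcomp Require Import mpoly ring zify.
From mathcomp Require boolp.
Set Implicit Arguments. Unset Strict Implicit. Unset Printing Implicit Defensive.
Import GRing.Theory Num.Theory.
Local Open Scope ring_scope.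

(** Put [S := C[x,y,z]] and let [J] be the Jacobian ideal of [f], of degree [d = 2k].
    Near freeness with exponents [d1 + d2 = d] gives
    [dim (S/J)_t = (d-1)^2 - d1 (d-1-d1) - 1 >= 3k(k-1)] for all large [t], and forces
    every form of large degree killed modulo [J] by the variables to lie in [J] (a Koszul
    chase through the resolution).  By a homogeneous Nullstellensatz, forms of large degree
    lying in [J] locally at each singular point then lie in [J], so [dim (S/J)_t] is at most
    [n2 + 4 n3]: the local algebra is spanned by [1] at a node and by [1, r, s, rs] at a
    triple point, where [r], [s] are the equations of two of the branches.  Two of the
    conics meet in at most four points, hence [n2 + 3 n3 <= 2k(k-1)], and
    [3 (n2 + 4 n3) <= 8k(k-1) < 9k(k-1)]. *)

(** * Forms and their homogeneous components *)

(** The lower bound comes from the graded strands of the resolution: with [d1 = k - j] and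
    [d2 = k + j] the codimension is [3k(k-1) + j(j-1)]. The upper bound involves no local rings,
    sheaves or intersection multiplicities: local membership at a point means membership after
    multiplication by a polynomial that does not vanish there. Only upper bounds on the local
    codimensions matter, so the spanning sets are never shown to be independent. The bridge is the
    Nullstellensatz applied to the colon ideal [(J : g)] of a form [g] lying in [J] locally at every
    singular point. A zero of [(J : g)] would be a singular point, yet [(J : g)] contains a form not
    vanishing there; so powers of all the variables belong to [(J : g)], and they are removed one at
    a time. Finiteness of the singular locus is not assumed: it results from the count of
    incidences, and the bound of four common points is a statement about two symmetric matrices of
    size three. *)

Section Polynomials.
Variables (F : fieldType) (n : nat).
Local Notation S := {mpoly F[n]}.
Implicit Types (p q w y : S) (v : 'I_n -> F).

Lemma pihomogM e s p w : p \is e.-homog ->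
  pihomog mdeg s (p * w) =
  if (e <= s)%N then p * pihomog mdeg (s - e) w else 0.
Proof.
move=> hp; rewrite {1}[w]mpolyE [in X in if _ then X else _](mpolyE w).
rewrite big_distrr raddf_sum /=.
have E m : pihomog mdeg s (p * (w@_m *: 'X_[m])) =
   if (e <= s)%N then p * pihomog mdeg (s - e) (w@_m *: 'X_[m]) else 0.
  have hm : p * (w@_m *: 'X_[m]) \is (e + mdeg m).-homog.
    by apply: dhomogM => //; apply: dhomogZ; rewrite dhomogX.
  rewrite [pihomog _ (s - e) _]linearZ /= pihomogX.
  case: (eqVneq (e + mdeg m)%N s) => [<-|ne].
    by rewrite pihomog_dE // leq_addr addKn eqxx.
  rewrite (pihomog_ne0 ne hm); case: leqP => // le.
  case: eqP => [eq|_]; last by rewrite scaler0 mulr0.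
  by case/eqP: ne; rewrite eq subnKC.
under eq_bigr do rewrite E.
case: (e <= s)%N; last by rewrite big1.
by rewrite -big_distrr raddf_sum.
Qed.

(* The coefficient of degree [s - a], set to [0] when [s < a]. *)
Definition hcoef (s a : nat) w : S :=
  if (a <= s)%N then pihomog mdeg (s - a) w else 0.

Lemma hcoef_homog s a w : hcoef s a w \is (s - a).-homog.
Proof. by rewrite /hcoef; case: ifP => _; rewrite ?pihomogP ?rpred0. Qed.

Lemma hcoef_mul e s p w : p \is e.-homog ->
  pihomog mdeg s (p * w) = p * hcoef s e w.
Proof. by move=> hp; rewrite (pihomogM _ _ hp) /hcoef; case: ifP; rewrite ?mulr0. Qed.

(** Take the component of degree [s] of both sides. This is how arbitrary witnesses given by
    exactness become homogeneous ones. *)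
Lemma sum_mul_homog m s (a : 'I_m -> nat) (G H : 'I_m -> S) p :
  p \is s.-homog -> (forall i, G i \is (a i).-homog) ->
  p = \sum_i H i * G i -> p = \sum_i hcoef s (a i) (H i) * G i.
Proof.
move=> hp hG e; rewrite -{1}(pihomog_dE hp) e raddf_sum; apply: eq_bigr => i _.
by rewrite /= mulrC (hcoef_mul _ _ (hG i)) mulrC.
Qed.

(** The polynomials congruent to their substitution modulo the ['X_i - tnth s i] are closed under
    sums and products and include constants and variables. *)
Lemma sub_comp_mpoly (s : n.-tuple S) p :
  exists H : 'I_n -> S, p = p \mPo s + \sum_i H i * ('X_i - tnth s i).
Proof.
pose Q p := exists H : 'I_n -> S, p = p \mPo s + \sum_i H i * ('X_i - tnth s i).
have QD p1 p2 : Q p1 -> Q p2 -> Q (p1 + p2).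
  move=> [H1 e1] [H2 e2]; exists (fun i => H1 i + H2 i).
  rewrite {1}e1 {1}e2 raddfD /= addrACA -big_split; congr (_ + _).
  by apply: eq_bigr => i _; rewrite mulrDl.
have QM p1 p2 : Q p1 -> Q p2 -> Q (p1 * p2).
  move=> [H1 e1] [H2 e2]; exists (fun i => p2 * H1 i + (p1 \mPo s) * H2 i).
  under eq_bigr do rewrite mulrDl -!mulrA.
  rewrite big_split -!big_distrr /= rmorphM /=.
  have sw (a b c : S) : a = b + c -> c = a - b by move=> ->; rewrite addrC addKr.
  rewrite (sw _ _ _ e1) (sw _ _ _ e2).
  ring.
have QC c : Q c%:MP.
  by exists (fun=> 0); rewrite comp_mpolyC big1 ?addr0 // => i _; rewrite mul0r.
have QX i : Q 'X_i.
  exists (fun j => (j == i)%:R); rewrite comp_mpolyXU -tnth_nth (bigD1 i) //= eqxx mul1r.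
  by rewrite big1 ?addr0 ?subrKC // => j /negPf ->; rewrite mul0r.
change (Q p); rewrite [p]mpolyE.
apply: (big_ind Q) => [||m _]; [by rewrite -mpolyC0|exact: QD|].
rewrite -mul_mpolyC; apply: (QM) => //; rewrite mpolyXE_id.
apply: (big_ind Q) => [||i _]; [by rewrite -mpolyC1|exact: QM|].
elim: (m i) => [|e IH]; first by rewrite expr0 -mpolyC1.
by rewrite exprS; apply: (QM).
Qed.

Lemma comp_mpoly_scale_homog e p v y : p \is e.-homog ->
  p \mPo [tuple v i *: y | i < n] = p.@[v] *: y ^+ e.
Proof.
move/dhomogP=> hp; rewrite comp_mpolyE mevalE scaler_suml !big_seq.
apply: eq_bigr => m /hp /= <-; rewrite -scalerA; congr (_ *: _).
under eq_bigr do rewrite tnth_mktuple exprZn.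
by rewrite scaler_prod /= mdegE expr_sum.
Qed.

(** Substituting [v i *: y] for each variable turns a form into its value at [v] times [y ^+ e]. A
    linear form [y] with value 1 at [v] gives the expansion of the form at the point [v]. *)
Lemma homog_mod_point e p v y : p \is e.-homog ->
  exists H : 'I_n -> S, p = p.@[v] *: y ^+ e + \sum_i H i * ('X_i - v i *: y).
Proof.
move=> hp; have [H e1] := sub_comp_mpoly [tuple v i *: y | i < n] p.
exists H; rewrite {1}e1 (comp_mpoly_scale_homog _ _ hp).
by under eq_bigr do rewrite tnth_mktuple.
Qed.

Lemma meval_homog_scale e p v c : p \is e.-homog ->
  p.@[fun i => c * v i] = c ^+ e * p.@[v].
Proof.
move/dhomogP=> hp; rewrite !mevalE big_distrr !big_seq; apply: eq_bigr => m /hp /= <-.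
under eq_bigr do rewrite exprMn.
by rewrite big_split /= mdegE expr_sum mulrCA.
Qed.

Lemma mderiv_homog e i p : p \is e.-homog -> p^`M(i) \is e.-1.-homog.
Proof.
move/dhomogP=> hp; apply/dhomogP => m; rewrite mcoeff_msupp mcoeff_deriv => nz.
have /hp /= : (m + U_(i))%MM \in msupp p.
  by rewrite mcoeff_msupp; apply: contraNneq nz => ->; rewrite mul0rn.
by rewrite mdegD mdeg1 => <-; rewrite addn1.
Qed.

Lemma euler_homog e p : p \is e.-homog ->
  \sum_i 'X_i * p^`M(i) = e%:R *: p.
Proof.
move/dhomogP=> hp; rewrite {2}[p]mpolyE scaler_sumr.
rewrite [in LHS](mpolyE p).
under eq_bigr do rewrite raddf_sum big_distrr.
rewrite exchange_big !big_seq /=; apply: eq_bigr => m /hp /= <-.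
under eq_bigr => i _.
  rewrite mderivZ mderivX -scalerAr -scalerAr.
  have -> : (m i)%:R *: ('X_i * 'X_[F, m - U_(i)]) = (m i)%:R *: 'X_[m].
    have [->|nz] := eqVneq (m i) 0%N; first by rewrite !scale0r.
    by rewrite -mpolyXD addmC submK // lep1mP.
  over.
rewrite -scaler_sumr -scaler_suml -natr_sum -mdegE.
by rewrite !scalerA mulrC.
Qed.

End Polynomials.

(** * Homogeneous Nullstellensatz *)

Section Ideals.
Variable S : comNzRingType.

Definition is_ideal (I : S -> Prop) :=
  [/\ I 0, (forall a b, I a -> I b -> I (a + b)) & (forall a b, I b -> I (a * b))].

Definition ideal_adjoin (I : S -> Prop) (c g : S) := exists a b, I a /\ g = a + b * c.

Lemma is_ideal_adjoin I c : is_ideal I -> is_ideal (ideal_adjoin I c).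
Proof.
move=> [I0 ID IM]; split.
- by exists 0, 0; rewrite mul0r addr0.
- move=> _ _ [a1 [b1 [h1 ->]]] [a2 [b2 [h2 ->]]]; exists (a1 + a2), (b1 + b2).
  by split; [exact: ID|rewrite mulrDl addrACA].
- move=> u _ [a1 [b1 [h1 ->]]]; exists (u * a1), (u * b1).
  by split; [exact: IM|rewrite mulrDr mulrA].
Qed.

Lemma sub_ideal_adjoin (I : S -> Prop) c g : I g -> ideal_adjoin I c g.
Proof. by move=> h; exists g, 0; rewrite mul0r addr0. Qed.

Lemma mem_ideal_adjoin I c : is_ideal I -> ideal_adjoin I c c.
Proof. by move=> [I0 _ _]; exists 0, 1; rewrite mul1r add0r. Qed.

Lemma ideal_sum (I : S -> Prop) (T : Type) (s : seq T) (P : pred T) (E : T -> S) :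
  is_ideal I -> (forall i, P i -> I (E i)) -> I (\sum_(i <- s | P i) E i).
Proof. by move=> [I0 ID _] h; apply: (big_ind I). Qed.

Lemma ideal_opp I a : is_ideal I -> I a -> I (- a).
Proof. by move=> [_ _ IM] h; rewrite -mulN1r; apply: IM. Qed.

Lemma ideal_sub I a b : is_ideal I -> I a -> I b -> I (a - b).
Proof. by move=> hI ha hb; case: (hI) => _ ID _; apply: ID => //; apply: ideal_opp. Qed.

Lemma ideal_colon I g : is_ideal I -> is_ideal (fun u => I (u * g)).
Proof.
move=> [I0 ID IM]; split; first by rewrite mul0r.
  by move=> a b ha hb; rewrite mulrDl; apply: ID.
by move=> a b hb; rewrite -mulrA; apply: IM.
Qed.

End Ideals.

Section BinaryForms.
Variables (F : closedFieldType) (S : comAlgType F) (x y : S).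

(** The homogenization of [P] in degree [t]; a deficit in the degree of [P] appears as a power of
    [y]. *)
Definition binary_form (t : nat) (P : {poly F}) : S :=
  \sum_(j < t.+1) P`_j *: (x ^+ j * y ^+ (t - j)).

Lemma binary_form_mulXsubC t (P : {poly F}) a : (size P <= t.+1)%N ->
  binary_form t.+1 (('X - a%:P) * P) = (x - a *: y) * binary_form t P.
Proof.
move=> sP; rewrite /binary_form.
under eq_bigr do rewrite mulrBl coefB coefXM coefCM scalerBl.
rewrite sumrB mulrBl big_ord_recl /= scale0r add0r; congr (_ - _).
  rewrite big_distrr; apply: eq_bigr => j _ /=.
  by rewrite /bump /= subSS exprS -scalerAr mulrA.
rewrite big_ord_recr /= (nth_default _ sP) mulr0 scale0r addr0 big_distrr.
apply: eq_bigr => j _ /=; have le : (j <= t)%N by rewrite -ltnS.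
rewrite (subSn le) exprS mulrCA -[RHS]scalerAr -scalerAl scalerA.
by rewrite [in LHS]mulrC.
Qed.

Lemma binary_form_split t (P : {poly F}) : P != 0 -> (size P <= t.+1)%N ->
  exists s : seq F, exists r : nat,
    binary_form t P = lead_coef P *: (y ^+ r * \prod_(a <- s) (x - a *: y)).
Proof.
move=> nz sP; have [s e] := closed_field_poly_normal P.
have szs : size P = (size s).+1.
  by rewrite e size_scale ?lead_coef_eq0 // size_prod_XsubC.
exists s, (t - size s)%N.
have bZ c Q u : binary_form u (c *: Q) = c *: binary_form u Q.
  by rewrite scaler_sumr; apply: eq_bigr => j _; rewrite coefZ scalerA.
rewrite [in LHS]e bZ; congr (_ *: _).
have {}szs : (size s <= t)%N by rewrite -ltnS -szs.
elim: s t szs {nz sP P e} => [|a s IH] t /=.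
  move=> _; rewrite !big_nil mulr1 subn0 /binary_form big_ord_recl /= coefC /=.
  rewrite scale1r expr0 mul1r subn0 big1 ?addr0 // => j _.
  by rewrite coefC scale0r.
case: t => // t; rewrite ltnS => le; rewrite !big_cons binary_form_mulXsubC.
  by rewrite IH // subSS mulrCA.
by rewrite size_prod_XsubC.
Qed.

(** Suppose adjoining the first factor captures [y ^+ k = u + b * (x - a *: y)] with [u] in [I].
    Multiplying by [y ^+ r] and the remaining factors removes that factor from the product at the
    price of [k] more powers of [y]. If this happened for every factor, a power of [y] would lie in
    [I]. *)
Lemma ideal_linear_factor (I : S -> Prop) (s : seq F) r : is_ideal I ->
  I (y ^+ r * \prod_(a <- s) (x - a *: y)) -> (forall k, ~ I (y ^+ k)) ->
  exists a, forall k, ~ ideal_adjoin I (x - a *: y) (y ^+ k).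
Proof.
move=> idI; case: (idI) => I0 ID IM.
elim: s r => [|a s IH] r; first by rewrite big_nil mulr1 => h /(_ r).
rewrite big_cons => h nI.
have [//|ne] := boolp.EM (exists a, forall k, ~ ideal_adjoin I (x - a *: y) (y ^+ k)).
have [k hk] : exists k, ideal_adjoin I (x - a *: y) (y ^+ k).
  apply: boolp.contrapT => h1; apply: ne; exists a => k hk; apply: h1; by exists k.
have [u [b [hu e]]] := hk; apply: (IH (k + r)%N) => //.
rewrite exprD e.
set Q := \prod_(a <- s) _.
have -> : (u + b * (x - a *: y)) * y ^+ r * Q =
  (y ^+ r * Q) * u + b * (y ^+ r * ((x - a *: y) * Q)) by ring.
by apply: ID; apply: IM.
Qed.

Lemma ideal_binary_form (I : S -> Prop) t (P : {poly F}) : is_ideal I ->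
  P != 0 -> (size P <= t.+1)%N -> I (binary_form t P) -> (forall k, ~ I (y ^+ k)) ->
  exists a, forall k, ~ ideal_adjoin I (x - a *: y) (y ^+ k).
Proof.
move=> idI nz sP; have [s [r ->]] := binary_form_split nz sP => h.
apply: (@ideal_linear_factor I s r idI).
case: (idI) => _ _ IM; rewrite -[_ * _](@scalerK _ _ (lead_coef P)) ?lead_coef_eq0 //.
by rewrite -mulr_algl; apply: IM.
Qed.

End BinaryForms.

(** The coordinates of the zero are chosen one at a time: the binary form in ['X_i] and ['X_j]
    splits into linear factors, one of which can be adjoined without capturing a power of ['X_j].
    Modulo the final ideal a form [h] of degree [e] is [h.@[v] *: 'X_j ^+ e], so it can lie there
    only if its value at [v] is zero. *)
Lemma homog_nullstellensatz (F : closedFieldType) n (I : {mpoly F[n]} -> Prop) (j : 'I_n) :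
  is_ideal I ->
  (forall i, exists (t : nat) (P : {poly F}), [/\ P != 0, (size P <= t.+1)%N & I (binary_form 'X_i 'X_j t P)]) ->
  (forall k, ~ I ('X_j ^+ k)) ->
  exists v : 'I_n -> F, v j = 1 /\
    forall e h, h \is e.-homog -> I h -> h.@[v] = 0.
Proof.
move=> idI hb nI; pose y : {mpoly F[n]} := 'X_j.
have [v [I' [idI' subI nI' hv]]] : exists v : 'I_n -> F, exists I' : {mpoly F[n]} -> Prop,
   [/\ is_ideal I', (forall h, I h -> I' h), (forall k, ~ I' (y ^+ k)) &
     forall i, i \in enum 'I_n -> I' ('X_i - v i *: y)].
  have := enum_uniq 'I_n; elim: (enum 'I_n) => [|i s IH] /=; first by exists (fun=> 0), I.
  move=> /andP[nis us]; have [v [I' [idI' subI nI' hv]]] := IH us.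
  have [t [P [nzP szP hP]]] := hb i.
  have [a ha] := @ideal_binary_form _ _ 'X_i y I' t P idI' nzP szP (subI _ hP) nI'.
  exists (fun l => if l == i then a else v l), (ideal_adjoin I' ('X_i - a *: y)); split=> //.
  - exact: is_ideal_adjoin.
  - by move=> h hh; apply/sub_ideal_adjoin/subI.
  - move=> l; rewrite in_cons; case: eqP => [-> _|_ /= ls]; first exact: mem_ideal_adjoin.
    exact/sub_ideal_adjoin/hv.
case: (idI') => I0 ID IM; exists v.
have {}hv i : I' ('X_i - v i *: y) by apply: hv; rewrite mem_enum.
have unscale c k : I' (c *: y ^+ k) -> c = 0.
  move=> h; apply/eqP; apply/negPn/negP => nz; apply: (nI' k).
  by rewrite -[y ^+ k](scalerK nz) -mulr_algl; apply: IM.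
split.
  have := hv j; rewrite -/y -{1}(scale1r y) -scalerBl => /(unscale _ 1%N) /eqP.
  by rewrite subr_eq0 => /eqP.
move=> e h hh /subI h1; have [H e1] := homog_mod_point v y hh.
apply: (unscale _ e); rewrite -[_ *: _](addrK (\sum_i H i * ('X_i - v i *: y))) -e1.
by apply: ideal_sub => //; apply: ideal_sum => // i _; apply: IM.
Qed.

(** * Koszul relations and the Hilbert function of the resolution *)

Lemma sum_ord3 (V : nmodType) (f : 'I_3 -> V) : \sum_i f i = f 0 + f 1 + f 2%:R.
Proof.
rewrite !big_ord_recl big_ord0 addr0 addrA.
by congr (f _ + f _ + f _); apply/val_inj.
Qed.

Lemma koszul_cocycle (R : comPzRingType) (V : lmodType R) (x0 x1 x2 : R) (u0 u1 u2 : V) :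
  x2 *: (x1 *: u0 - x0 *: u1) - x1 *: (x2 *: u0 - x0 *: u2) +
    x0 *: (x2 *: u1 - x1 *: u2) = 0.
Proof.
rewrite !scalerBr !scalerA (mulrC x2 x1) (mulrC x2 x0) (mulrC x1 x0) opprB.
by rewrite [X in X + _]addrC subrKA subrKA subrr.
Qed.

Section Koszul.
Variables (F : fieldType) (n : nat).
Local Notation S := {mpoly F[n]}.

Lemma mpolyXU_neq0 (i : 'I_n) : 'X_i != 0 :> S.
Proof. by rewrite -msupp_eq0 msuppX. Qed.

Lemma homog_mulX i t (p : S) : p \is t.-homog -> 'X_i * p \is t.+1.-homog.
Proof.
move=> h; have hX : ('X_i : S) \is 1.-homog by rewrite dhomogX /= mdeg1.
exact: (dhomogM hX h).
Qed.

(** Setting the variables of [T] to zero leaves ['X_i] times the image of [p] equal to zero, so [p]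
    vanishes under the substitution and is a combination of those variables. *)
Lemma mul_var_mem_vars (T : pred 'I_n) i (p : S) (G : 'I_n -> S) : ~~ T i ->
  'X_i * p = \sum_(l | T l) G l * 'X_l ->
  exists H : 'I_n -> S, p = \sum_(l | T l) H l * 'X_l.
Proof.
move=> nT e; pose s : n.-tuple S := [tuple if T l then 0 else 'X_l | l < n].
have sX l : 'X_l \mPo s = if T l then 0 else 'X_l.
  by rewrite comp_mpolyXU -tnth_nth tnth_mktuple.
have [H eH] := sub_comp_mpoly s p; exists H.
have p0 : p \mPo s = 0.
  apply/eqP; have := congr1 (comp_mpoly s) e; rewrite rmorphM /= sX (negPf nT) rmorph_sum /=.
  rewrite big1 => [/eqP|l Tl]; last by rewrite rmorphM /= sX Tl mulr0.
  by rewrite mulf_eq0 (negPf (mpolyXU_neq0 _)).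
rewrite {1}eH p0 add0r [RHS]big_mkcond; apply: eq_bigr => l _.
by rewrite tnth_mktuple; case: (T l); rewrite ?subr0 // subrr mulr0.
Qed.

Lemma koszul1 i j (p q : S) : i != j -> 'X_i * p = 'X_j * q ->
  exists r, p = 'X_j * r /\ q = 'X_i * r.
Proof.
move=> ne e; have [|H eH] := @mul_var_mem_vars (pred1 j) i p (fun=> q) ne.
  by rewrite big_pred1_eq e mulrC.
rewrite big_pred1_eq mulrC in eH; exists (H j); split=> //.
by apply: (mulfI (mpolyXU_neq0 j)); rewrite -e eH mulrCA.
Qed.

(** Exactness of the Koszul complex on three variables. The relation puts [wjk] in the ideal of
    ['X_j] and ['X_k]; substituting leaves a relation between two variables, settled by
    [koszul1]. *)
Lemma koszul2 i j k (wij wik wjk : S) : i != j -> i != k -> j != k ->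
  'X_k * wij - 'X_j * wik + 'X_i * wjk = 0 ->
  exists vi vj vk : S, [/\ wij = 'X_j * vi - 'X_i * vj,
    wik = 'X_k * vi - 'X_i * vk & wjk = 'X_k * vj - 'X_j * vk].
Proof.
move=> nij nik njk e; have nkj : k != j by rewrite eq_sym.
have [||H] := @mul_var_mem_vars (pred2 j k) i wjk (fun l => if l == j then wik else - wij).
- by rewrite /= negb_or nij.
- rewrite (bigD1 j) /= ?eqxx // (bigD1 k) /= ?eqxx ?orbT // big1 ?addr0.
    rewrite (negPf nkj).
    have -> : 'X_i * wjk = ('X_k * wij - 'X_j * wik + 'X_i * wjk) - ('X_k * wij - 'X_j * wik) by ring.
    rewrite e; ring.
  by move=> l /andP[/andP[/orP[]->]]; rewrite ?andbF.
rewrite (bigD1 j) /= ?eqxx // (bigD1 k) /= ?eqxx ?orbT // big1 ?addr0; last first.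
  by move=> l /andP[/andP[/orP[]->]]; rewrite ?andbF.
move=> ew.
have [r [er1 er2]] : exists r, wik - 'X_i * H j = 'X_k * r /\ wij + 'X_i * H k = 'X_j * r.
  apply: koszul1 => //; apply/eqP; rewrite -subr_eq0 -oppr_eq0; apply/eqP.
  rewrite -e ew; ring.
exists r, (H k), (- H j); split.
- by rewrite -er2; ring.
- by rewrite -er1; ring.
- by rewrite ew; ring.
Qed.

End Koszul.

Lemma dim_exact_sequence (F : fieldType) (U0 U1 U2 U3 : vectType F)
    (g : {linear U1 -> U0}) (a : {linear U2 -> U1}) (b : {linear U3 -> U2}) :
  (forall u, g u = 0 <-> exists w, u = a w) ->
  (forall w, a w = 0 <-> exists z, w = b z) ->
  (forall z, b z = 0 -> z = 0) ->
  exists2 W : {vspace U0}, (forall x, x \in W <-> exists u, x = g u) &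
  (\dim W + \dim {: U2} = \dim {: U1} + \dim {: U3})%N.
Proof.
move=> exg exa injb.
have img (U V : vectType F) (h : {linear U -> V}) x : x \in limg (linfun h) <-> exists u, x = h u.
  split=> [/memv_imgP[u _]|[u ->]]; first by rewrite lfunE; exists u.
  by apply/memv_imgP; exists u; rewrite ?memvf ?lfunE.
have kerg : lker (linfun g) = limg (linfun a).
  apply/vspaceP => u; rewrite memv_ker lfunE.
  by apply/eqP/idP => [/exg /img|/img /exg].
have kera : lker (linfun a) = limg (linfun b).
  apply/vspaceP => u; rewrite memv_ker lfunE.
  by apply/eqP/idP => [/exa /img|/img /exa].
have kerb : lker (linfun b) = 0%VS.
  apply/vspaceP => z; rewrite memv_ker lfunE memv0.
  by apply/eqP/eqP => [/injb|->] //; rewrite linear0.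
exists (limg (linfun g)); first exact: img.
have := limg_ker_dim (linfun g) fullv; have := limg_ker_dim (linfun a) fullv.
have := limg_ker_dim (linfun b) fullv; rewrite !capfv kerg kera kerb dimv0 add0n.
by move=> <- <- <-; rewrite addnC -addnA addnC.
Qed.

(** * Socle and Hilbert function read off the resolution *)

Section Resolution.
Variables (F : fieldType) (d0 b0 : nat) (a0 : 'I_3 -> nat).
Local Notation S := {mpoly F[3]}.
Variables (G : 'rV[S]_3) (A : 'M[S]_3) (B : 'cV[S]_3).
Hypothesis G_homog : forall i, G 0 i \is d0.-homog.
Hypothesis A_homog : forall i j, A i j \is (a0 j).-homog.
Hypothesis B_homog : forall i, B i 0 \is (b0 - a0 i).-homog.
Hypothesis a0_le : forall i, (a0 i <= b0)%N.
Hypothesis GA0 : G *m A = 0.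
Hypothesis G_exact : forall u : 'cV[S]_3, G *m u = 0 -> exists w : 'cV[S]_3, u = A *m w.
Hypothesis AB0 : A *m B = 0.
Hypothesis A_exact : forall w : 'cV[S]_3, A *m w = 0 -> exists z : 'cV[S]_1, w = B *m z.
Hypothesis B_inj : forall z : 'cV[S]_1, B *m z = 0 -> z = 0.

Definition row_ideal (g : S) := exists u : 'cV[S]_3, g%:M = G *m u.

Lemma row_idealP g : row_ideal g <-> exists u : 'I_3 -> S, g = \sum_i u i * G 0 i.
Proof.
split=> [[u e]|[u e]].
  exists (fun i => u i 0); have /(congr1 (fun M : 'M__ => M 0 0)) := e.
  by rewrite !mxE eqxx mulr1n => ->; apply: eq_bigr => i _; rewrite mulrC.
exists (\col_i u i); apply/matrixP => i j; rewrite !mxE !ord1 eqxx mulr1n e.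
by apply: eq_bigr => l _; rewrite mxE mulrC.
Qed.

Lemma row_ideal_is_ideal : is_ideal row_ideal.
Proof.
split.
- by exists 0; rewrite mulmx0 raddf0.
- by move=> a b [u hu] [v hv]; exists (u + v); rewrite mulmxDr -hu -hv raddfD.
- by move=> a b [u hu]; exists (a *: u); rewrite -scalemxAr -hu scalar_mxM mul_scalar_mx.
Qed.

Lemma row_ideal_homog t g : g \is t.-homog -> row_ideal g ->
  exists2 u : 'cV[S]_3, (forall i, u i 0 \is (t - d0).-homog) & g%:M = G *m u.
Proof.
move=> hg /row_idealP [u e].
exists (\col_i hcoef t d0 (u i)); first by move=> i; rewrite mxE hcoef_homog.
apply/matrixP => i j; rewrite !mxE !ord1 eqxx mulr1n.
rewrite {1}(sum_mul_homog hg G_homog e).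
by apply: eq_bigr => l _; rewrite mxE mulrC.
Qed.

Lemma G_exact_homog s (u : 'cV[S]_3) : (forall i, u i 0 \is s.-homog) ->
  G *m u = 0 -> exists2 w : 'cV[S]_3, (forall i, w i 0 \is (s - a0 i).-homog) & u = A *m w.
Proof.
move=> hu /G_exact [w e]; exists (\col_i hcoef s (a0 i) (w i 0)).
  by move=> i; rewrite mxE hcoef_homog.
apply/colP => i; rewrite mxE.
have {}e : u i 0 = \sum_l w l 0 * A i l.
  by rewrite e mxE; apply: eq_bigr => l _; rewrite mulrC.
rewrite (sum_mul_homog (hu i) (A_homog i) e).
by apply: eq_bigr => l _; rewrite mxE mulrC.
Qed.

Lemma A_exact_homog s (w : 'cV[S]_3) : (b0 <= s)%N ->
  (forall i, w i 0 \is (s - a0 i).-homog) ->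
  A *m w = 0 -> exists2 z : S, z \is (s - b0).-homog & w = B *m z%:M.
Proof.
move=> le hw /A_exact [z e]; exists (pihomog mdeg (s - b0) (z 0 0)); first exact: pihomogP.
apply/colP => i; rewrite !mxE big_ord1 mxE eqxx mulr1n.
rewrite -(pihomog_dE (hw i)) e mxE big_ord1 (pihomogM _ _ (B_homog i)).
have le1 := a0_le i.
rewrite leq_sub2r //; congr (_ * pihomog _ _ _); lia.
Qed.

(** Write ['X_i * g = G u_i]. The syzygies ['X_j u_i - 'X_i u_j] are [A w_ij], and the Koszul
    differential of the [w_ij] is [B z]. The form [z] is the only obstruction: its degree
    [t + 3 - d0 - b0] is positive, so it is a combination of the variables and the [w_ij] can be
    corrected into Koszul boundaries. Then [u_0] is divisible by ['X_0] modulo the image of [A], and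
    dividing exhibits [g] in the ideal. *)
Lemma socle_in_row_ideal t g : g \is t.-homog -> (d0 + b0 <= t)%N ->
  (forall i, row_ideal ('X_i * g)) -> row_ideal g.
Proof.
move=> hg le hX.
have hXg i : 'X_i * g \is t.+1.-homog by exact: homog_mulX.
have [u hu] : exists u : 'I_3 -> 'cV[S]_3, forall i,
    (forall l, u i l 0 \is (t.+1 - d0).-homog) /\ ('X_i * g)%:M = G *m u i.
  apply: (@fin_all_exists _ _ (fun i (ui : 'cV[S]_3) =>
    (forall l, ui l 0 \is (t.+1 - d0).-homog) /\ ('X_i * g)%:M = G *m ui)) => i.
  by have [ui h1 h2] := row_ideal_homog (hXg i) (hX i); exists ui.
pose s := (t.+1 - d0)%N.
have W i j : exists2 w : 'cV[S]_3, (forall l, w l 0 \is (s.+1 - a0 l).-homog) &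
    'X_j *: u i - 'X_i *: u j = A *m w.
  apply: G_exact_homog => [l|].
    by rewrite !mxE rpredB // homog_mulX //; [case: (hu i)|case: (hu j)].
  rewrite mulmxBr -!scalemxAr -(proj2 (hu i)) -(proj2 (hu j)) -!mul_scalar_mx -!scalar_mxM.
  by rewrite mulrCA subrr.
pose i0 : 'I_3 := 0; pose i1 : 'I_3 := 1; pose i2 : 'I_3 := 2%:R.
have [w01 hw01 e01] := W i0 i1; have [w02 hw02 e02] := W i0 i2; have [w12 hw12 e12] := W i1 i2.
have [|l||z hz ez] := @A_exact_homog s.+2 ('X_i2 *: w01 - 'X_i1 *: w02 + 'X_i0 *: w12).
- rewrite /s; lia.
- have le1 := a0_le l.
  have hh (w : 'cV[S]_3) i : (forall l, w l 0 \is (s.+1 - a0 l).-homog) ->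
      'X_i * w l 0 \is (s.+2 - a0 l).-homog.
    move=> hw; have -> : (s.+2 - a0 l = (s.+1 - a0 l).+1)%N by rewrite /s; lia.
    exact: homog_mulX.
  by rewrite !mxE rpredD ?rpredB // hh.
- by rewrite mulmxDr mulmxBr -!scalemxAr -e01 -e02 -e12; apply: koszul_cocycle.
(* At the origin and with [y = 0], the expansion writes a form of positive degree as a combination
   of the variables. *)
have [H eH] := homog_mod_point (fun=> 0) 0 hz.
have {}eH : z = H i0 * 'X_i0 + H i1 * 'X_i1 + H i2 * 'X_i2.
  rewrite [LHS]eH expr0n (_ : (_ - _ == 0)%N = false) ?scaler0 ?add0r; last by rewrite /s; lia.
  by rewrite sum_ord3 ?scale0r ?scaler0 !subr0.
(* The coefficients of [z] tell which multiples of [B] to remove for the three vectors to satisfy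
   the Koszul relation; [A *m B = 0] makes this invisible to [A]. *)
have [v0 [v1 [v2 [E01 E02 E12]]]] : exists v0 v1 v2 : 'cV[S]_3,
   [/\ w01 - H i2 *: B = 'X_i1 *: v0 - 'X_i0 *: v1,
       w02 + H i1 *: B = 'X_i2 *: v0 - 'X_i0 *: v2 &
       w12 - H i0 *: B = 'X_i2 *: v1 - 'X_i1 *: v2].
  have [V hV] : exists V : 'I_3 -> S * S * S, forall r,
     [/\ (w01 - H i2 *: B) r 0 = 'X_i1 * (V r).1.1 - 'X_i0 * (V r).1.2,
       (w02 + H i1 *: B) r 0 = 'X_i2 * (V r).1.1 - 'X_i0 * (V r).2 &
       (w12 - H i0 *: B) r 0 = 'X_i2 * (V r).1.2 - 'X_i1 * (V r).2].
    apply: (@fin_all_exists _ _ (fun r (V : S * S * S) =>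
     [/\ (w01 - H i2 *: B) r 0 = 'X_i1 * V.1.1 - 'X_i0 * V.1.2,
       (w02 + H i1 *: B) r 0 = 'X_i2 * V.1.1 - 'X_i0 * V.2 &
       (w12 - H i0 *: B) r 0 = 'X_i2 * V.1.2 - 'X_i1 * V.2])) => r.
    have [||||x [y [x' [h1 h2 h3]]]] :=
      @koszul2 _ _ i0 i1 i2 ((w01 - H i2 *: B) r 0) ((w02 + H i1 *: B) r 0)
        ((w12 - H i0 *: B) r 0) => //.
      have := congr1 (fun M : 'cV_3 => M r 0) ez.
      rewrite !mxE big_ord1 mxE eqxx mulr1n eH => e1.
      transitivity (('X_i2 * w01 r 0 - 'X_i1 * w02 r 0 + 'X_i0 * w12 r 0)
         - B r 0 * (H i0 * 'X_i0 + H i1 * 'X_i1 + H i2 * 'X_i2)); first by ring.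
      by rewrite -e1; ring.
    by exists (x, y, x').
  exists (\col_r (V r).1.1), (\col_r (V r).1.2), (\col_r (V r).2).
  by split; apply/colP => r; case: (hV r) => h1 h2 h3; rewrite ?h1 ?h2 ?h3 !mxE.
have shift (w w' : 'cV[S]_3) c : w - c *: B = w' -> A *m w = A *m w'.
  by move=> <-; rewrite mulmxBr -scalemxAr AB0 scaler0 subr0.
have K (i j : 'I_3) (vi vj w : 'cV[S]_3) :
    'X_j *: u i - 'X_i *: u j = A *m w -> A *m w = A *m ('X_j *: vi - 'X_i *: vj) ->
    'X_j *: (u i - A *m vi) = 'X_i *: (u j - A *m vj).
  move=> e1 e2; apply/eqP; rewrite -subr_eq0; apply/eqP.
  transitivity (('X_j *: u i - 'X_i *: u j) - A *m ('X_j *: vi - 'X_i *: vj)).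
    rewrite mulmxBr -!scalemxAr; apply/colP => r; rewrite !mxE; ring.
  by rewrite e1 e2 subrr.
have K01 := K _ _ _ _ _ e01 (shift _ _ _ E01).
have [q hq] : exists q : 'I_3 -> S, forall r, (u i0 - A *m v0) r 0 = 'X_i0 * q r.
  apply: (@fin_all_exists _ _ (fun r (x : S) => (u i0 - A *m v0) r 0 = 'X_i0 * x)) => r.
  have /(congr1 (fun M : 'cV_3 => M r 0)) := K01; rewrite ![fun_of_matrix (_ *: _) _ _]mxE.
  by move=> /koszul1 [//|x [hx _]]; exists x.
exists (\col_r q r).
have e0 : ('X_i0 * g)%:M = G *m (u i0 - A *m v0).
  by rewrite (proj2 (hu i0)) mulmxBr mulmxA GA0 mul0mx subr0.
have e1 : u i0 - A *m v0 = 'X_i0 *: (\col_r q r) by apply/colP => r; rewrite hq !mxE.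
have := e0; rewrite e1 -scalemxAr scalar_mxM mul_scalar_mx => /(congr1 (fun M : 'M_1 => M 0 0)).
rewrite ![fun_of_matrix (_ *: _) _ _]mxE => /(mulfI (mpolyXU_neq0 _ _)) e2.
by apply/matrixP => r r'; rewrite !ord1 e2.
Qed.

Section HilbertFunction.
(* [V t] stands for the space of forms of degree [t], later [dhomog 3 F t]. *)
Variables (V : nat -> vectType F) (emb : forall t, {linear V t -> S})
  (hproj : forall t, {linear S -> V t}).
Hypothesis emb_inj : forall t, injective (emb t).
Hypothesis emb_homog : forall t (x : V t), emb t x \is t.-homog.
Hypothesis hproj_id : forall t (p : S), p \is t.-homog -> emb t (hproj t p) = p.
Arguments emb {t}.

(** [resG], [resA] and [resB] are the strands of multiplication by [G], [A] and [B]. The projections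
    make them linear in all degrees; they agree with the matrix products once [d0 + s = t] and
    [b0 <= s]. *)
Definition resG s t (u : V s * V s * V s) : V t :=
  hproj t (G 0 0 * emb u.1.1 + G 0 1 * emb u.1.2 + G 0 2%:R * emb u.2).

Definition resA s (w : V (s - a0 0) * V (s - a0 1) * V (s - a0 2%:R)) : V s * V s * V s :=
  let r i := hproj s (A i 0 * emb w.1.1 + A i 1 * emb w.1.2 + A i 2%:R * emb w.2) in
  (r 0, r 1, r 2%:R).

Definition resB s (z : V (s - b0)) : V (s - a0 0) * V (s - a0 1) * V (s - a0 2%:R) :=
  (hproj _ (B 0 0 * emb z), hproj _ (B 1 0 * emb z), hproj _ (B 2%:R 0 * emb z)).

Lemma hproj_mul3_linear t (x1 x2 x3 : S) e1 e2 e3 : linear (fun u : V e1 * V e2 * V e3 =>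
  hproj t (x1 * emb u.1.1 + x2 * emb u.1.2 + x3 * emb u.2)).
Proof.
move=> c u v; rewrite -[RHS]linearP; congr (hproj t _) => /=.
by rewrite !linearP /= !mulrDr -!scalerAr !scalerDr [RHS]addrACA; congr (_ + _); rewrite addrACA.
Qed.

Lemma resG_is_linear s t : linear (@resG s t).
Proof. exact: hproj_mul3_linear. Qed.
HB.instance Definition _ s t := GRing.isLinear.Build F _ _ _ (@resG s t) (@resG_is_linear s t).

Lemma resA_is_linear s : linear (@resA s).
Proof. by move=> c u v; congr (_, _, _); apply: hproj_mul3_linear. Qed.
HB.instance Definition _ s := GRing.isLinear.Build F _ _ _ (@resA s) (@resA_is_linear s).

Lemma resB_is_linear s : linear (@resB s).
Proof.
move=> c u v; rewrite /resB.
have E t (x : S) : hproj t (x * emb (c *: u + v)) = c *: hproj t (x * emb u) + hproj t (x * emb v).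
  by rewrite -[RHS]linearP; congr (hproj t _); rewrite linearP /= mulrDr -scalerAr.
by rewrite !E.
Qed.
HB.instance Definition _ s := GRing.isLinear.Build F _ _ _ (@resB s) (@resB_is_linear s).

Lemma dim_prod3 (U1 U2 U3 : vectType F) :
  \dim {: (U1 * U2 * U3)%type} = (\dim {: U1} + \dim {: U2} + \dim {: U3})%N.
Proof. by rewrite !dimvf. Qed.

Definition col3 (T : Type) (x y z : T) : 'cV[T]_3 :=
  \col_i (if i == 0 then x else if i == 1 then y else z).

Lemma col3_eta (u : 'cV[S]_3) : u = col3 (u 0 0) (u 1 0) (u 2%:R 0).
Proof.
by apply/colP => -[[|[|[|//]]] h]; rewrite mxE /=; congr (u _ _); apply: val_inj.
Qed.

Lemma col3_inj (x y z x' y' z' : S) : col3 x y z = col3 x' y' z' -> [/\ x = x', y = y' & z = z'].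
Proof.
by move=> /colP e; split; [have := e 0|have := e 1|have := e 2%:R]; rewrite !mxE.
Qed.

Lemma mulmx_col3 m (M : 'M[S]_(m, 3)) x y z i :
  (M *m col3 x y z) i 0 = M i 0 * x + M i 1 * y + M i 2%:R * z.
Proof. by rewrite mxE sum_ord3 !mxE. Qed.

Lemma homog_emb t (x : S) : x \is t.-homog -> exists X : V t, x = emb X.
Proof. by move=> h; exists (hproj t x); rewrite hproj_id. Qed.

Lemma homog_mul_emb e s (p : S) (x : V s) : p \is e.-homog -> p * emb x \is (e + s).-homog.
Proof. by move=> hp; apply: dhomogM => //; apply: emb_homog. Qed.

Lemma resG_mulmx s t u : (d0 + s)%N = t ->
  (emb (@resG s t u))%:M = G *m col3 (emb u.1.1) (emb u.1.2) (emb u.2).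
Proof.
move=> e; apply/matrixP => i j; rewrite !ord1 mulmx_col3 mxE eqxx mulr1n.
by apply: hproj_id; rewrite -e !rpredD // homog_mul_emb.
Qed.

Lemma resA_mulmx s (w : V (s - a0 0) * V (s - a0 1) * V (s - a0 2%:R)) : (b0 <= s)%N ->
  col3 (emb (resA w).1.1) (emb (resA w).1.2) (emb (resA w).2) =
  A *m col3 (emb w.1.1) (emb w.1.2) (emb w.2).
Proof.
move=> le; rewrite [RHS]col3_eta !mulmx_col3.
have hA i l (x : V (s - a0 l)) : A i l * emb x \is s.-homog.
  by have := homog_mul_emb x (A_homog i l); rewrite subnKC // (leq_trans (a0_le l)).
congr col3; apply: hproj_id; apply: rpredD; [apply: rpredD| |apply: rpredD| |apply: rpredD|];
  exact: hA.
Qed.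

Lemma resB_mulmx s (z : V (s - b0)) : (b0 <= s)%N ->
  col3 (emb (resB z).1.1) (emb (resB z).1.2) (emb (resB z).2) = B *m (emb z)%:M.
Proof.
move=> le; rewrite [RHS]col3_eta.
have E l : (B *m (emb z)%:M) l 0 = B l 0 * emb z by rewrite mxE big_ord1 mxE eqxx mulr1n.
have hB l : B l 0 * emb z \is (s - a0 l).-homog.
  have le1 := a0_le l; rewrite (_ : s - a0 l = (b0 - a0 l) + (s - b0))%N; last by lia.
  exact: homog_mul_emb.
by rewrite !E; congr col3; apply: hproj_id.
Qed.

(** Rank-nullity along the strand of degree [t]. The bound on [t] keeps every truncated subtraction
    exact. *)
Lemma row_ideal_vspace_abstract t : (d0 + b0 <= t)%N ->
  exists2 W : {vspace V t}, (forall g : V t, g \in W <-> row_ideal (emb g)) &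
  (\dim W + (\dim {: V (t - d0 - a0 0%R)} + \dim {: V (t - d0 - a0 1%R)} + \dim {: V (t - d0 - a0 2%:R%R)})
   = 3 * \dim {: V (t - d0)} + \dim {: V (t - d0 - b0)})%N.
Proof.
move=> le; pose s := (t - d0)%N; rewrite -/s.
have es : (d0 + s)%N = t by rewrite /s; lia.
have les : (b0 <= s)%N by rewrite /s; lia.
have c30 : col3 0 0 0 = 0 :> 'cV[S]_3 by rewrite [RHS]col3_eta !mxE.
have [|||W hW dW] := @dim_exact_sequence F _ _ _ _ (@resG s t) (@resA s) (@resB s).
- move=> [[u1 u2] u3]; split=> [e|[w e]].
    have Gu : G *m col3 (emb u1) (emb u2) (emb u3) = 0.
      by rewrite -(resG_mulmx (u1, u2, u3) es) e linear0 raddf0.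
    have hu i : col3 (emb u1) (emb u2) (emb u3) i 0 \is s.-homog.
      by rewrite mxE; case: ifP => _; [|case: ifP => _]; apply: emb_homog.
    have [w hw] := G_exact_homog hu Gu.
    have [x1 e1] := homog_emb (hw 0); have [x2 e2] := homog_emb (hw 1).
    have [x3 e3] := homog_emb (hw 2%:R).
    rewrite [w]col3_eta e1 e2 e3 -(resA_mulmx (x1, x2, x3) les) => /col3_inj [E1 E2 E3].
    by exists (x1, x2, x3); congr (_, _, _); apply: emb_inj.
  have := resG_mulmx (u1, u2, u3) es; rewrite e resA_mulmx // mulmxA GA0 mul0mx.
  by move=> /matrixP /(_ 0 0); rewrite !mxE eqxx mulr1n => E; apply: emb_inj; rewrite linear0.
- move=> [[w1 w2] w3]; split=> [e|[z e]].
    have Aw : A *m col3 (emb w1) (emb w2) (emb w3) = 0.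
      by rewrite -(resA_mulmx (w1, w2, w3) les) e /= !linear0 c30.
    have hw i : col3 (emb w1) (emb w2) (emb w3) i 0 \is (s - a0 i).-homog.
      rewrite mxE; have : i \in [:: 0; 1; 2%:R] by case: i => -[|[|[|//]]] h.
      by rewrite !inE => /or3P[] /eqP -> /=; apply: emb_homog.
    have [z hz] := A_exact_homog les hw Aw.
    have [x ex] := homog_emb hz; rewrite ex -(resB_mulmx x les) => /col3_inj [E1 E2 E3].
    by exists x; congr (_, _, _); apply: emb_inj.
  have := resA_mulmx (w1, w2, w3) les; rewrite e resB_mulmx // mulmxA AB0 mul0mx.
  by rewrite -c30 => /col3_inj [E1 E2 E3]; congr (_, _, _); apply: emb_inj; rewrite linear0.
- move=> z e; have Bz : B *m (emb z)%:M = 0 by rewrite -(resB_mulmx z les) e /= !linear0 c30.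
  have /matrixP /(_ 0 0) := B_inj Bz.
  by rewrite !mxE eqxx mulr1n => e1; apply: emb_inj; rewrite linear0.
exists W; last first.
  move: dW; rewrite !dim_prod3 => ->.
  by rewrite !mulSn mul0n addn0 addnA.
move=> g; split.
  by move=> /hW [u ->]; eexists; apply: resG_mulmx.
have hg : emb g \is t.-homog by apply: emb_homog.
move=> /(row_ideal_homog hg) [u]; rewrite -/s => hu.
have [x1 e1] := homog_emb (hu 0); have [x2 e2] := homog_emb (hu 1).
have [x3 e3] := homog_emb (hu 2%:R).
rewrite [u]col3_eta e1 e2 e3 -(resG_mulmx (x1, x2, x3) es) => /matrixP /(_ 0 0).
by rewrite !mxE eqxx !mulr1n => e; apply/hW; exists (x1, x2, x3); apply: emb_inj.
Qed.

End HilbertFunction.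

End Resolution.

Section HomogeneousPart.
Variables (F : fieldType) (t : nat).

Definition dhomog_part (p : {mpoly F[3]}) : dhomog 3 F t := DHomog (pihomogP mdeg t p).

Lemma dhomog_part_is_linear : linear dhomog_part.
Proof. by move=> c p q; apply/val_inj; rewrite /= linearP. Qed.
HB.instance Definition _ :=
  GRing.isLinear.Build F {mpoly F[3]} (dhomog 3 F t) _ dhomog_part dhomog_part_is_linear.

Lemma dim_dhomog3 : (2 * \dim {: dhomog 3 F t} = (t + 2) * (t + 1))%N.
Proof.
rewrite dimvf /dim /= -[in LHS](bin_sub (leq_addr 2 t)) addKn mulnC.
by have := bin_ffact (t + 2) 2; rewrite (_ : 2`! = 2)%N // => ->; rewrite !ffactnS ffactn0 muln1 addn2 addn1.
Qed.

End HomogeneousPart.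

Definition jacobian_ideal (F : fieldType) (f : {mpoly F[3]}) := row_ideal (grad f).

(** With [r = d1], [m = d2] and [r + m = d], the constant [c = r^2 + m^2 + r m - r - 2 m] equals
    [(d-1)^2 - r (d-1-r) - 1], the total Tjurina number of a nearly free curve. *)
Lemma nearly_free_hilbert (F : fieldType) k (f : {mpoly F[3]}) :
  f \is (2 * k).-homog -> nearly_free f ->
  exists T c : nat, [/\ (3 * (k * k.-1) <= c)%N,
    (forall t, (T <= t)%N -> exists2 W : {vspace dhomog 3 F t},
       (forall g, g \in W <-> jacobian_ideal f (val g)) &
       (\dim W + c = \dim {: dhomog 3 F t})%N) &
    (forall t g, (T <= t)%N -> g \is t.-homog ->
       (forall i, jacobian_ideal f ('X_i * g)) -> jacobian_ideal f g)].
Proof.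
move=> hf [d [ds [es [[nzf hfd [A [B [[ds1 dsle _ hA hB] [GA0 Gex AB0 Aex Binj]]]]]] sumd eqd ees]]].
have ed : d = (2 * k)%N by apply: (dhomog_uniq nzf hfd hf).
have o0 : (@Ordinal 3 0 isT) = 0 by apply/val_inj.
have o1 : (@Ordinal 3 1 isT) = 1 by apply/val_inj.
have o2 : (@Ordinal 3 2 isT) = 2%:R by apply/val_inj.
rewrite o0 o1 o2 in sumd eqd ees.
set r := ds 0 in sumd; set m := ds 1 in sumd eqd ees.
have rm : (r <= m)%N by apply: dsle.
have r1 : (1 <= r)%N by apply: ds1.
have dsm i : (ds i <= m)%N.
  rewrite eqd; apply: dsle; case: i => i lti /=; exact: lti.
have hG i : grad f 0 i \is (d - 1).-homog by rewrite mxE subn1; apply: mderiv_homog.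
(* The second syzygy has degree [e1 = d + m], that is [m + 1] once the shift [d - 1] of the gradient
   is taken off. *)
have hB' i : B i 0 \is (m.+1 - ds i).-homog.
  have := hB i 0; rewrite /min_graded_entry (_ : 0 = Ordinal (isT : 0 < 3 - 2)%N); last by apply/val_inj.
  rewrite ees ifT; last by have := dsm i; lia.
  by rewrite (_ : d + m - _ = m.+1 - ds i)%N //; have := dsm i; lia.
have dsm' i : (ds i <= m.+1)%N by apply: leqW.
pose c := (r ^ 2 + m ^ 2 + r * m - r - 2 * m)%N.
exists (d - 1 + m.+1)%N, c; split.
(* With [r = k - j] and [m = k + j] one finds [c = 3k(k-1) + j(j-1)]. *)
- have [j ej] : exists j, m = (r + 2 * j)%N by exists (k - r)%N; lia.
  have ek : k = (r + j)%N by lia.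
  rewrite /c ek ej; nia.
- move=> t le.
  have [|||W hW dW] := @row_ideal_vspace_abstract F (d - 1) m.+1 ds (grad f) A B hG hA hB' dsm'
     GA0 Gex AB0 Aex Binj (fun t => dhomog 3 F t) (fun t => @mpoly_of_dhomog 3 F t)
     (@dhomog_part F) _ _ _ t le.
  - by move=> u; apply: val_inj.
  - by move=> u x; apply: dhomog_is_dhomog.
  - by move=> u p; apply: pihomog_dE.
  exists W => //; move: dW; rewrite -/r -/m -eqd.
  (* The least degree allowed is [d + m = 3r + 2e]; writing [t] as [n] more than it clears all
     truncated subtractions. *)
  have [e ee] : exists e, m = (r + e)%N by exists (m - r)%N; lia.
  have [n en] : exists n, t = (n + 3 * r + 2 * e)%N by exists (t - 3 * r - 2 * e)%N; lia.
  have ec : (c + r + 2 * m = r * r + m * m + r * m)%N by rewrite /c ee; nia.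
  have -> : (t - (d - 1) = n + r + e + 1)%N by lia.
  have -> : (n + r + e + 1 - r = n + e + 1)%N by lia.
  have -> : (n + r + e + 1 - m = n + 1)%N by lia.
  have -> : (n + r + e + 1 - m.+1 = n)%N by lia.
  have := dim_dhomog3 F n; have := dim_dhomog3 F (n + 1); have := dim_dhomog3 F (n + e + 1).
  have := dim_dhomog3 F (n + r + e + 1); have := dim_dhomog3 F t.
  rewrite ee in ec.
  move: (\dim _) (\dim _) (\dim _) (\dim _) (\dim _) (\dim _) => h1 h2 h3 h4 h5 h6.
  rewrite en => E1 E2 E3 E4 E5 E6; lia.
- move=> t g le hg hX.
  exact: (@socle_in_row_ideal F (d - 1) m.+1 ds (grad f) A B hG hA hB' dsm' GA0 Gex AB0 Aex t g hg le hX).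
Qed.

(** * From local to global membership *)

Section Codimension.
Variables (F : fieldType) (V : vectType F).

(** Adjoin vectors of [Q] outside the current subspace while there are any; the dimension of [V]
    bounds the number of steps. *)
Lemma subspace_vspace (Q : V -> Prop) : Q 0 -> (forall a x y, Q x -> Q y -> Q (a *: x + y)) ->
  exists W : {vspace V}, forall x, x \in W <-> Q x.
Proof.
move=> Q0 QD.
suff H n (U : {vspace V}) : (\dim {: V} - \dim U <= n)%N -> (forall x, x \in U -> Q x) ->
    exists W : {vspace V}, forall x, x \in W <-> Q x.
  apply: (H _ 0%VS (leqnn _)) => x; by rewrite memv0 => /eqP ->.
elim: n U => [|n IH] U hn hU.
  have Ufull : U = fullv.
    by apply/eqP; rewrite eqEdim subvf; move: hn; rewrite leqn0 subn_eq0.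
  by exists U => x; split; [exact: hU|rewrite Ufull memvf].
have [hQ|nQ] := boolp.EM (forall x, Q x -> x \in U).
  by exists U => x; split; [exact: hU|exact: hQ].
have [x [Qx xU]] : exists x, Q x /\ x \notin U.
  apply: boolp.contrapT => h; apply: nQ => x Qx; apply/negPn/negP => xU; apply: h.
  by exists x.
have lt : (\dim U < \dim (U + <[x]>))%N.
  rewrite (ltn_leqif (dimv_leqif_sup (addvSl U <[x]>))).
  by apply: contra xU => /subvP; apply; rewrite memvE addvSr.
apply: (IH (U + <[x]>)%VS); first by have := dimvS (subvf (U + <[x]>)); lia.
move=> y /memv_addP [u uU [w /vlineP[a ->] ->]].
by rewrite addrC; apply: QD => //; apply: hU.
Qed.

Lemma dim_bigcap m (W : 'I_m -> {vspace V}) (n : 'I_m -> nat) :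
  (forall i, \dim {: V} <= \dim (W i) + n i)%N ->
  (\dim {: V} <= \dim (\bigcap_i W i)%VS + \sum_i n i)%N.
Proof.
move=> h; apply: (big_ind2 (fun (U : {vspace V}) k => \dim {: V} <= \dim U + k)%N) => //.
  by rewrite addn0.
move=> U k U' k' h1 h2; have := dimv_sum_cap U U'; have := dimvS (subvf (U + U')); lia.
Qed.

Lemma dim_complement (W : {vspace V}) (X : seq V) :
  (forall x, exists2 y, y \in <<X>>%VS & x - y \in W) -> (\dim {: V} <= \dim W + size X)%N.
Proof.
move=> h; have -> : fullv = (W + <<X>>)%VS.
  apply/eqP; rewrite eqEsubv subvf andbT; apply/subvP => x _.
  by have [y yX xy] := h x; rewrite -(subrK y x) memv_add.
by apply: leq_trans (dimv_add_leqif _ _) _; rewrite leq_add2l dim_span.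
Qed.

(** Otherwise the map sending [a] to [\sum_i a i *: x i] would be injective with image meeting [W]
    trivially, and [W] plus this image would be too large. *)
Lemma linear_relation_mod (W : {vspace V}) n (x : 'I_n -> V) : (\dim {: V} < \dim W + n)%N ->
  exists2 a : 'I_n -> F, (exists i, a i != 0) & \sum_i a i *: x i \in W.
Proof.
move=> lt.
pose phi (a : 'rV[F]_n) := \sum_i a 0 i *: x i.
have phi_lin : linear phi.
  move=> c a b; rewrite /phi scaler_sumr -big_split; apply: eq_bigr => i _.
  by rewrite !mxE scalerDl scalerA.
pose phiL : {linear 'rV[F]_n -> V} := HB.pack phi (GRing.isLinear.Build _ _ _ _ phi phi_lin).
pose f := linfun phiL.
have [e|ne] := eqVneq (f @^-1: W)%VS 0%VS.
  have kf : lker f = 0%VS.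
    apply/eqP; rewrite -subv0 -e; apply/subvP => a; rewrite memv_ker -memv_preim => /eqP ->.
    exact: mem0v.
  have df : \dim (limg f) = n by rewrite limg_dim_eq ?kf ?capv0 // dimvf /dim /= mul1n.
  have cap0 : (W :&: limg f = 0)%VS.
    apply/eqP; rewrite -subv0; apply/subvP => y; rewrite memv_cap => /andP[yW /memv_imgP[a _ ey]].
    have : a \in (f @^-1: W)%VS by rewrite -memv_preim -ey.
    by rewrite e memv0 ey => /eqP ->; rewrite linear0 mem0v.
  have := dimv_sum_cap W (limg f); rewrite cap0 dimv0 df.
  have := dimvS (subvf (W + limg f)); lia.
pose a := vpick (f @^-1: W)%VS.
have nza : a != 0 by rewrite vpick0.
exists (fun i => a 0 i).
  apply/existsP; apply: contraNT nza; rewrite negb_exists => /forallP h.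
  by apply/eqP/rowP => i; rewrite mxE; apply/eqP; have := h i; rewrite negbK.
by have := memv_pick (f @^-1: W); rewrite -memv_preim lfunE.
Qed.

End Codimension.

Section HomogeneousLocalization.
Variable F : fieldType.
Local Notation S := {mpoly F[3]}.

(** The denominator is homogeneous so that its non-vanishing depends only on the projective point:
    it gets evaluated at a multiple of [v]. *)
Definition local_at (v : 'I_3 -> F) (I : S -> Prop) (g : S) :=
  exists e u, [/\ u \is e.-homog, u.@[v] != 0 & I (u * g)].

Lemma local_at_ideal v I : is_ideal I -> is_ideal (local_at v I).
Proof.
move=> [I0 ID IM]; split.
- exists 0%N, 1; split; [exact: dhomog1|by rewrite meval1 oner_eq0|by rewrite mulr0].
- move=> a b [e1 [u1 [h1 n1 J1]]] [e2 [u2 [h2 n2 J2]]].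
  exists (e1 + e2)%N, (u1 * u2); split; [exact: dhomogM|by rewrite mevalM mulf_neq0|].
  rewrite (_ : _ * _ = u2 * (u1 * a) + u1 * (u2 * b)); last by ring.
  by apply: ID; apply: IM.
- move=> a b [e1 [u1 [h1 n1 J1]]]; exists e1, u1; split=> //.
  by rewrite mulrCA; apply: IM.
Qed.

End HomogeneousLocalization.

Section LocalToGlobal.
Variables (F : closedFieldType) (J : {mpoly F[3]} -> Prop) (T c : nat).
Local Notation S := {mpoly F[3]}.
Hypothesis J_ideal : is_ideal J.
Hypothesis J_vspace : forall t, (T <= t)%N -> exists2 W : {vspace dhomog 3 F t},
  (forall g, g \in W <-> J (val g)) & (\dim W + c = \dim {: dhomog 3 F t})%N.
Hypothesis J_socle : forall t g, (T <= t)%N -> g \is t.-homog ->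
  (forall i, J ('X_i * g)) -> J g.

(** If all [N j] are positive, ['X_i * g] satisfies the hypothesis with [N i] lowered by one.
    Induction on the sum of the exponents puts it in [J] for every [i], and the socle condition
    gives [g]. *)
Lemma var_torsion_mem (N : 'I_3 -> nat) t g : (T <= t)%N -> g \is t.-homog ->
  (forall j, J ('X_j ^+ N j * g)) -> J g.
Proof.
case: (J_ideal) => _ _ JM.
move: {2}(\sum_j N j)%N (leqnn (\sum_j N j)) => n.
elim: n N t g => [|n IH] N t g.
  rewrite leqn0 sum_nat_eq0 => /forallP /(_ 0) /eqP e _ _ /(_ 0).
  by rewrite e expr0 mul1r.
move=> hn le hg hJ.
have [[i Ni0]|nz] := boolp.EM (exists i, N i = 0%N).
  by have := hJ i; rewrite Ni0 expr0 mul1r.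
have {}nz i : (0 < N i)%N by rewrite lt0n; apply/eqP => e; apply: nz; exists i.
apply: (J_socle le hg) => i.
apply: (IH (fun l => N l - (l == i))%N t.+1) => [|||j].
- rewrite -ltnS (leq_trans _ hn) // (bigD1 i) //= [in X in (_ < X)%N](bigD1 i) //= eqxx.
  rewrite -addSn leq_add //; first by have := nz i; lia.
  by apply: leq_sum => j _; apply: leq_subr.
- exact: leqW.
- exact: homog_mulX.
- case: eqP => [->|_]; last by rewrite subn0 mulrCA; apply: JM.
  by rewrite mulrA -exprSr subn1 prednK.
Qed.

(** In a degree [t >= c] the [t + 1] monomials in these two variables outnumber the codimension of
    [J]. *)
Lemma binary_form_mem i j : exists (t : nat) (P : {poly F}),
  [/\ P != 0, (size P <= t.+1)%N & J (binary_form 'X_i 'X_j t P)].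
Proof.
pose t := maxn T c; have [W hW dW] := @J_vspace t (leq_maxl _ _).
have hm (l : 'I_t.+1) : ('X_i ^+ l * 'X_j ^+ (t - l) : S) \is t.-homog.
  have hX (r : 'I_3) n : ('X_r ^+ n : S) \is n.-homog.
    have := @dhomogMn _ _ mdeg 1 ('X_r : S) n; rewrite mul1n; apply.
    by rewrite dhomogX /= mdeg1.
  by have := dhomogM (hX i l) (hX j (t - l)%N); rewrite subnKC // -ltnS.
have [|a [l nzl] ha] := @linear_relation_mod _ _ W t.+1 (fun l => DHomog (hm l)).
  by rewrite -dW ltn_add2l ltnS leq_maxr.
have co (l' : 'I_t.+1) : (\poly_(l0 < t.+1) a (inord l0))`_l' = a l'.
  by rewrite coef_poly ltn_ord inord_val.
exists t, (\poly_(l < t.+1) a (inord l)); split; last 1 first.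
- move/hW: ha; congr J; rewrite raddf_sum /binary_form.
  by apply: eq_bigr => l' _; rewrite co.
- by apply: contraNneq nzl => e; rewrite -co e coef0.
- exact: size_poly.
Qed.

(** Were [c] larger than the sum, then in a large degree the forms locally in [J] at every [p i]
    would span a space of larger dimension than [J]; but each such form belongs to [J]. *)
Lemma local_codim_bound m (p : 'I_m -> 'I_3 -> F) (n : 'I_m -> nat) T' :
  (forall v j, v j = 1 -> (forall e h, h \is e.-homog -> J h -> h.@[v] = 0) ->
     exists i a, a != 0 /\ v =1 (fun l => a * p i l)) ->
  (forall i t, (T' <= t)%N -> exists X : seq (dhomog 3 F t), (size X <= n i)%N /\
     forall x, exists2 y, y \in <<X>>%VS & local_at (p i) J (val (x - y))) ->
  (c <= \sum_i n i)%N.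
Proof.
move=> hz hloc; rewrite leqNgt; apply/negP => ltc.
pose t := maxn T T'; have leT : (T <= t)%N := leq_maxl _ _.
have [WJ hWJ dWJ] := J_vspace leT.
have [W hW] : exists W : 'I_m -> {vspace dhomog 3 F t}, forall i, forall x,
    x \in W i <-> local_at (p i) J (val x).
  apply: (@fin_all_exists _ _ (fun i (W : {vspace dhomog 3 F t}) =>
    forall x, x \in W <-> local_at (p i) J (val x))) => i.
  have [L0 LD LM] := local_at_ideal (p i) J_ideal.
  apply: subspace_vspace => // a x y hx hy /=.
  by apply: LD => //; rewrite -mul_mpolyC; apply: LM.
have dW i : (\dim {: dhomog 3 F t} <= \dim (W i) + n i)%N.
  have [X [sX hX]] := hloc i t (leq_maxr _ _).
  apply: (leq_trans (n := \dim (W i) + size X)); last by rewrite leq_add2l.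
  by apply: dim_complement => x; have [y yX hy] := hX x; exists y => //; apply/hW.
have /dim_bigcap dcap := dW.
have /subvPn [g gW gJ] : ~~ (\bigcap_i W i <= WJ)%VS.
  by apply/negP => /dimvS; move: dcap dWJ ltc; lia.
have hg : val g \is t.-homog by apply: dhomog_is_dhomog.
case/negP: gJ; apply/hWJ.
suff [N hN] : exists N : 'I_3 -> nat, forall j, J ('X_j ^+ N j * val g).
  exact: (var_torsion_mem leT hg hN).
apply: (@fin_all_exists _ _ (fun j N => J ('X_j ^+ N * val g))) => j.
apply: boolp.contrapT => nN.
have idg := ideal_colon (val g) J_ideal.
have [|k Jk|v [vj hv]] := @homog_nullstellensatz F 3 _ j idg.
- move=> i; have [u [P [nz sz hP]]] := binary_form_mem i j; exists u, P; split=> //.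
  by case: (J_ideal) => _ _ JM; rewrite mulrC; apply: JM.
- by apply: nN; exists k.
have [|i [a [nza ea]]] := hz v j vj.
  move=> e h hh Jh; apply: (hv e h hh); case: (J_ideal) => _ _ JM.
  by rewrite mulrC; apply: JM.
have /hW [e [u [hu nu Ju]]] : g \in W i by apply: (subvP (bigcapv_inf i isT (subvv _))) gW.
have := hv e u hu Ju; rewrite (meval_eq _ ea) (meval_homog_scale _ _ hu) => /eqP.
by rewrite mulf_eq0 expf_eq0 (negPf nza) andbF (negPf nu).
Qed.

End LocalToGlobal.

(** * Local algebra at nodes and ordinary triple points *)

Section Localization.
Variables (F : fieldType) (n : nat) (v : 'I_n -> F).
Local Notation S := {mpoly F[n]}.

(** Unlike in [local_at], the denominator need not be homogeneous, which frees local computations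
    from degrees; [loc_gen_homog] restores homogeneity. *)
Definition loc (I : S -> Prop) (g : S) := exists2 u, u.@[v] != 0 & I (u * g).

Lemma loc_ideal I : is_ideal I -> is_ideal (loc I).
Proof.
move=> [I0 ID IM]; split.
- by exists 1; rewrite ?meval1 ?oner_eq0 // mulr0.
- move=> a b [u1 n1 J1] [u2 n2 J2]; exists (u1 * u2); first by rewrite mevalM mulf_neq0.
  rewrite (_ : _ * _ = u2 * (u1 * a) + u1 * (u2 * b)); last by ring.
  by apply: ID; apply: IM.
- by move=> a b [u n1 J1]; exists u => //; rewrite mulrCA; apply: IM.
Qed.

Lemma sub_loc (I : S -> Prop) g : I g -> loc I g.
Proof. by exists 1; rewrite ?meval1 ?oner_eq0 ?mul1r. Qed.

Lemma loc_cancel (I : S -> Prop) w g : w.@[v] != 0 -> loc I (w * g) -> loc I g.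
Proof.
move=> nw [u nu Iu]; exists (u * w); first by rewrite mevalM mulf_neq0.
by rewrite -mulrA.
Qed.

Lemma loc_trans (I I' : S -> Prop) g : (forall h, I h -> loc I' h) -> loc I g -> loc I' g.
Proof. by move=> h [u nu Iu]; apply: (loc_cancel nu); apply: h. Qed.

Lemma loc_cramer I a b a' b' x y : is_ideal I -> I (a * x + b * y) -> I (a' * x + b' * y) ->
  (a * b' - b * a').@[v] != 0 -> loc I x /\ loc I y.
Proof.
move=> idI h h' nD; case: (idI) => _ ID IM.
split; exists (a * b' - b * a') => //.
  have -> : (a * b' - b * a') * x = b' * (a * x + b * y) - b * (a' * x + b' * y) by ring.
  by apply: ideal_sub => //; apply: IM.
have -> : (a * b' - b * a') * y = a * (a' * x + b' * y) - a' * (a * x + b * y) by ring.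
by apply: ideal_sub => //; apply: IM.
Qed.

Section Generated.
Variables (m : nat) (G : 'I_m -> S) (a : 'I_m -> nat).

Definition gen_ideal (g : S) := exists H : 'I_m -> S, g = \sum_i H i * G i.

Lemma gen_ideal_is_ideal : is_ideal gen_ideal.
Proof.
split.
- by exists (fun=> 0); rewrite big1 // => i _; rewrite mul0r.
- move=> _ _ [H ->] [H' ->]; exists (fun i => H i + H' i).
  by rewrite -big_split; apply: eq_bigr => i _; rewrite mulrDl.
- move=> b _ [H ->]; exists (fun i => b * H i).
  by rewrite big_distrr; apply: eq_bigr => i _; rewrite /= mulrA.
Qed.

Lemma mem_gen_ideal i : gen_ideal (G i).
Proof.
exists (fun j => (j == i)%:R); rewrite (bigD1 i) //= eqxx mul1r big1 ?addr0 // => j.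
by move=> /negPf ->; rewrite mul0r.
Qed.

Hypothesis G_homog : forall i, G i \is (a i).-homog.

(* Some homogeneous component of the denominator is nonzero at [v], and the
   component of matching degree of the whole identity is again an identity. *)
Lemma loc_gen_homog t g : g \is t.-homog -> loc gen_ideal g ->
  exists e u H, [/\ u \is e.-homog, u.@[v] != 0,
    (forall i, H i \is (e + t - a i).-homog) & u * g = \sum_i H i * G i].
Proof.
move=> hg [u nu [H eH]].
have [e ne] : exists e, (pihomog mdeg e u).@[v] != 0.
  apply: boolp.contrapT => h; case/eqP: nu.
  have eu : u = \sum_(d < msize u) pihomog mdeg d u by apply: pihomog_partitionE.
  rewrite eu raddf_sum big1 // => e _ /=.
  by apply/eqP/negPn/negP => h1; apply: h; exists e.
exists e, (pihomog mdeg e u), (fun i => hcoef (e + t) (a i) (H i)); split=> //.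
- exact: pihomogP.
- by move=> i; apply: hcoef_homog.
have : pihomog mdeg (e + t) (u * g) = pihomog mdeg e u * g.
  by rewrite mulrC (pihomogM _ _ hg) leq_addl addnK mulrC.
move=> <-; rewrite eH raddf_sum; apply: eq_bigr => i _ /=.
by rewrite mulrC (hcoef_mul _ _ (G_homog i)) mulrC.
Qed.

End Generated.
End Localization.

Lemma ord3_split (j : 'I_3) : exists i1 i2 : 'I_3,
  forall (V : nmodType) (f : 'I_3 -> V), \sum_i f i = f j + f i1 + f i2.
Proof.
case: j => -[|[|[|//]]] h.
- exists 1, 2%:R => V f; rewrite sum_ord3; congr (f _ + _ + _); exact/val_inj.
- exists 0, 2%:R => V f; rewrite sum_ord3 [f 0 + _]addrC; congr (f _ + _ + _); exact/val_inj.
- exists 0, 1 => V f; rewrite sum_ord3 addrC addrA; congr (f _ + _ + _); exact/val_inj.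
Qed.

Section LocalAlgebra.
Variables (F : fieldType) (v : 'I_3 -> F) (j0 : 'I_3).
Local Notation S := {mpoly F[3]}.
Hypothesis vj0 : v j0 != 0.
Local Notation loc := (loc v).

(** A linear form with value 1 at [v]; its powers are homogeneous substitutes for the constant 1. *)
Definition unit_form : S := (v j0)^-1 *: 'X_j0.
Local Notation y := unit_form.

Lemma unit_form_homog m : y ^+ m \is m.-homog.
Proof.
have := @dhomogMn _ _ mdeg 1 y m; rewrite mul1n; apply.
by apply: dhomogZ; rewrite dhomogX /= mdeg1.
Qed.

Lemma meval_unit_form m : (y ^+ m).@[v] = 1.
Proof. by rewrite rmorphXn /= mevalZ mevalXU mulVf // expr1n. Qed.

Variables (r s : S) (dr dss : nat) (i k : 'I_3).
Hypothesis r_homog : r \is dr.-homog.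
Hypothesis s_homog : s \is dss.-homog.
Hypothesis rv : r.@[v] = 0.
Hypothesis sv : s.@[v] = 0.
(** A minor of the Jacobian matrix of [(r, s)]. When it is nonzero at [v] the branches are
    transversal, and [r] and [s] act as local coordinates. *)
Definition jac2 : S := r^`M(i) * s^`M(k) - r^`M(k) * s^`M(i).
Hypothesis jac2v : jac2.@[v] != 0.

Definition pair_gen (l : 'I_2) : S := if l == 0 then r else s.
Definition sq_gen (l : 'I_3) : S := if l == 0 then r ^+ 2 else if l == 1 then r * s else s ^+ 2.
Local Notation rs := (gen_ideal pair_gen).
Local Notation rs2 := (gen_ideal sq_gen).

Lemma pair_genP g : rs g <-> exists a b, g = a * r + b * s.
Proof.
split=> [[H ->]|[a [b ->]]]; first by exists (H ord0), (H (lift ord0 ord0)); rewrite !big_ord_recl big_ord0 addr0.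
by exists (fun l => if l == 0 then a else b); rewrite !big_ord_recl big_ord0 addr0.
Qed.

(* With [a_l := X_l - v_l y], one has r = R1 a1 + R2 a2 and s = S1 a1 + S2 a2, and the
   chain rule makes R1 S2 - R2 S1 divide [jac2] at [v]. *)
Lemma loc_rs_vanish t g : g \is t.-homog -> g.@[v] = 0 -> loc rs g.
Proof.
have idrs := gen_ideal_is_ideal pair_gen; have idl := loc_ideal v idrs.
pose a l : S := 'X_l - v l *: y.
have a0 : a j0 = 0 by rewrite /a scalerA divff // scale1r subrr.
have av l : (a l).@[v] = 0.
  by rewrite mevalB mevalZ mevalXU -[y]expr1 meval_unit_form mulr1 subrr.
have dec e h : h \is e.-homog -> h.@[v] = 0 -> exists H, h = \sum_l H l * a l.
  by move=> hh hv; have [H eH] := homog_mod_point v y hh; exists H; rewrite {1}eH hv scale0r add0r.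
have [i1 [i2 e12]] := ord3_split j0.
have [R eR] := dec _ _ r_homog rv; have [Q eQ] := dec _ _ s_homog sv.
have dH h H l : h = \sum_l H l * a l :> S ->
    (h^`M(l)).@[v] = (H i1).@[v] * ((a i1)^`M(l)).@[v] + (H i2).@[v] * ((a i2)^`M(l)).@[v].
  by rewrite e12 a0 mulr0 add0r => ->; rewrite mderivD !mderivM !mevalD !mevalM !av; ring.
have [l1 l2] : loc rs (a i1) /\ loc rs (a i2).
  apply: (@loc_cramer _ _ v _ (R i1) (R i2) (Q i1) (Q i2)) => //.
  - apply/pair_genP; exists 1, 0; rewrite mul1r mul0r addr0 eR e12 a0; ring.
  - apply/pair_genP; exists 0, 1; rewrite mul1r mul0r add0r eQ e12 a0; ring.
  - apply: contraNneq jac2v => e; rewrite /jac2 mevalB !mevalM.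
    rewrite !(dH _ _ _ eR) !(dH _ _ _ eQ); move: e; rewrite mevalB !mevalM => e.
    set A1 := (_^`M(i)).@[v]; set A2 := ((a i2)^`M(i)).@[v].
    set B1 := ((a i1)^`M(k)).@[v]; set B2 := ((a i2)^`M(k)).@[v].
    apply/eqP; transitivity (((R i1).@[v] * (Q i2).@[v] - (R i2).@[v] * (Q i1).@[v]) * (A1 * B2 - A2 * B1)).
      by ring.
    by rewrite e mul0r.
move=> hg gv; have [H ->] := dec _ _ hg gv; rewrite e12 a0 mulr0 add0r.
by case: idl => _ ID IM; apply: ID; apply: IM.
Qed.

Lemma loc_rs_quotient e m (u h : S) : u \is e.-homog -> u.@[v] != 0 ->
  h \is (e + m).-homog -> loc rs (h - (h.@[v] / u.@[v]) *: (u * y ^+ m)).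
Proof.
move=> hu nu hh; apply: (loc_rs_vanish (t := e + m)).
  by rewrite rpredB // dhomogZ // dhomogM // unit_form_homog.
by rewrite mevalB mevalZ mevalM meval_unit_form mulr1 divfK ?subrr.
Qed.

Lemma loc_rs2_mul g : loc rs g -> loc rs2 (g * r) /\ loc rs2 (g * s).
Proof.
have [_ ID IM] := gen_ideal_is_ideal sq_gen.
have [g0 g1 g2] : [/\ rs2 (r ^+ 2), rs2 (r * s) & rs2 (s ^+ 2)].
  by split; [exact: (mem_gen_ideal sq_gen 0)|exact: (mem_gen_ideal sq_gen 1)|
    exact: (mem_gen_ideal sq_gen 2%:R)].
move=> [u nu /pair_genP [a [b e]]]; split; exists u => //; rewrite mulrA e.
  have -> : (a * r + b * s) * r = a * r ^+ 2 + b * (r * s) by ring.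
  by apply: ID; apply: IM.
have -> : (a * r + b * s) * s = a * (r * s) + b * s ^+ 2 by ring.
by apply: ID; apply: IM.
Qed.

(** In [u * g = H0 * r + H1 * s] each coefficient may be replaced by its value at [v], times [u /
    u.@[v]] and a power of the unit form: the error vanishes at [v], so it is locally in [(r, s)]
    and contributes to the square of this ideal. *)
Lemma loc_rs_step t g : (dr <= t)%N -> (dss <= t)%N -> g \is t.-homog -> loc rs g ->
  exists a b, loc rs2 (g - (a *: (y ^+ (t - dr) * r) + b *: (y ^+ (t - dss) * s))).
Proof.
move=> ler les hg lg.
have hG l : pair_gen l \is (if l == 0 then dr else dss).-homog by rewrite /pair_gen; case: eqP.
have [e [u [H [hu nu hH eH]]]] := loc_gen_homog hG hg lg.
rewrite !big_ord_recl big_ord0 addr0 /pair_gen /= in eH.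
set l0 := ord0 in eH; set l1 := lift _ _ in eH.
have hH0 : H l0 \is (e + (t - dr)).-homog by have := hH l0; rewrite addnBA.
have hH1 : H l1 \is (e + (t - dss)).-homog by have := hH l1; rewrite addnBA.
exists ((H l0).@[v] / u.@[v]), ((H l1).@[v] / u.@[v]); apply: (loc_cancel nu).
have [k0 _] := loc_rs2_mul (loc_rs_quotient hu nu hH0); have [_ k1] := loc_rs2_mul (loc_rs_quotient hu nu hH1).
have [_ ID _] := loc_ideal v (gen_ideal_is_ideal sq_gen).
have := ID _ _ k0 k1; congr loc.
rewrite mulrBr eH -!mul_mpolyC; ring.
Qed.

Section Singularities.
Variables (f h : S) (J : S -> Prop).
Hypothesis J_ideal : is_ideal J.
Hypothesis J_deriv : forall l, J (f^`M(l)).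
Hypothesis J_f : J f.
Hypothesis hv : h.@[v] != 0.

(** The derivatives of [r * s * h] are linear in [r] and [s] once the term with the derivative of
    [h] is counted with [r]. Since [s] vanishes at [v], the determinant there is [- h^2 jac2]. *)
Lemma node_loc : f = r * s * h -> loc J r /\ loc J s.
Proof.
move=> ef.
apply: (@loc_cramer _ _ v _ (h * s^`M(i) + s * h^`M(i)) (h * r^`M(i))
  (h * s^`M(k) + s * h^`M(k)) (h * r^`M(k))) => //.
- by have := J_deriv i; congr J; rewrite ef !mderivM; ring.
- by have := J_deriv k; congr J; rewrite ef !mderivM; ring.
have -> : ((h * s^`M(i) + s * h^`M(i)) * (h * r^`M(k)) -
  h * r^`M(i) * (h * s^`M(k) + s * h^`M(k))).@[v] = - (h.@[v] ^+ 2 * jac2.@[v]).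
  by rewrite /jac2 !(mevalB, mevalM, mevalD) sv; ring.
by rewrite oppr_eq0 mulf_neq0 // expf_neq0.
Qed.

Lemma node_span t g : f = r * s * h -> g \is t.-homog -> loc J (g - g.@[v] *: y ^+ t).
Proof.
move=> /node_loc [lr ls] hg; have [_ ID IM] := loc_ideal v J_ideal.
apply: (loc_trans (I := rs)).
  by move=> _ /pair_genP [a [b ->]]; apply: ID; apply: IM.
apply: (loc_rs_vanish (t := t)).
  by rewrite rpredB // dhomogZ // unit_form_homog.
by rewrite mevalB mevalZ meval_unit_form mulr1 subrr.
Qed.

Section Triple.
Variables (q u al be : S).
Hypothesis f_eq : f = r * s * q * h.
Hypothesis q_eq : u * q = al * r + be * s.
Hypothesis alv : al.@[v] != 0.
Hypothesis bev : be.@[v] != 0.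
Hypothesis three_neq0 : 3%:R != 0 :> F.

(* Differentiating [u f = h (al r^2 s + be r s^2)] in two directions and eliminating,
   one controls both quadratic forms below modulo [r^2 s] and [r s^2]. *)
Lemma triple_loc : [/\ loc J (r ^+ 2 * s), loc J (r * s ^+ 2),
  loc J (al * r ^+ 2 + 2%:R * be * (r * s)) & loc J (be * s ^+ 2 + 2%:R * al * (r * s))].
Proof.
case: (J_ideal) => _ ID IM; have idl := loc_ideal v J_ideal; case: (idl) => _ IDl IMl.
have uf : u * f = h * (al * (r ^+ 2 * s) + be * (r * s ^+ 2)).
  rewrite f_eq (_ : u * _ = r * s * h * (u * q)); last by ring.
  by rewrite q_eq; ring.
(* [P1] and [P2] are [h] times the derivatives of [al r^2 s + be r s^2] in [r] and in [s], with [al]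
   and [be] held constant. *)
pose P1 := h * (be * s ^+ 2 + 2%:R * al * (r * s)).
pose P2 := h * (al * r ^+ 2 + 2%:R * be * (r * s)).
have D l : J ((h * al)^`M(l) * (r ^+ 2 * s) + (h * be)^`M(l) * (r * s ^+ 2) +
    r^`M(l) * P1 + s^`M(l) * P2).
  have : J (u^`M(l) * f + u * f^`M(l)) by apply: ID; apply: IM.
  rewrite -mderivM uf; congr J.
  by rewrite !expr2 !(mderivM, mderivD) /P1 /P2; ring.
pose g1 := s^`M(k) * (h * al)^`M(i) - s^`M(i) * (h * al)^`M(k).
pose d1 := s^`M(k) * (h * be)^`M(i) - s^`M(i) * (h * be)^`M(k).
pose g2 := r^`M(i) * (h * al)^`M(k) - r^`M(k) * (h * al)^`M(i).
pose d2 := r^`M(i) * (h * be)^`M(k) - r^`M(k) * (h * be)^`M(i).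
have E1 : J (jac2 * P1 + g1 * (r ^+ 2 * s) + d1 * (r * s ^+ 2)).
  have := ideal_sub J_ideal (IM s^`M(k) _ (D i)) (IM s^`M(i) _ (D k)); congr J.
  by rewrite /jac2 /g1 /d1; ring.
have E2 : J (jac2 * P2 + g2 * (r ^+ 2 * s) + d2 * (r * s ^+ 2)).
  have := ideal_sub J_ideal (IM r^`M(i) _ (D k)) (IM r^`M(k) _ (D i)); congr J.
  by rewrite /jac2 /g2 /d2; ring.
(* Multiplying the relations by [r] and [s] gives a linear system for [r^2 s] and [r s^2]. At [v]
   its rows are [jac2 h] times [(2 al, be)] and [(al, 2 be)], whence the factor [3 = 4 - 1]. *)
have [l1 l2] : loc J (r ^+ 2 * s) /\ loc J (r * s ^+ 2).
  apply: (@loc_cramer _ _ v _ (2%:R * jac2 * h * al + g1 * r) (jac2 * h * be + d1 * r)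
    (jac2 * h * al + g2 * s) (2%:R * jac2 * h * be + d2 * s)) => //.
  - by have := IM r _ E1; congr J; rewrite /P1; ring.
  - by have := IM s _ E2; congr J; rewrite /P2; ring.
  set M := (X in X != 0).
  have -> : M = 3%:R * (jac2.@[v] ^+ 2 * h.@[v] ^+ 2 * (al.@[v] * be.@[v])).
    by rewrite /M !(mevalB, mevalM, mevalD, mevalMn, meval1) rv sv; ring.
  by rewrite !(mulf_neq0, expf_neq0).
have jh : (jac2 * h).@[v] != 0 by rewrite mevalM mulf_neq0.
split=> //; apply: (loc_cancel jh).
  have := ideal_sub idl (ideal_sub idl (sub_loc v E2) (IMl g2 _ l1)) (IMl d2 _ l2).
  by congr loc; rewrite /P2; ring.
have := ideal_sub idl (ideal_sub idl (sub_loc v E1) (IMl g1 _ l1)) (IMl d1 _ l2).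
by congr loc; rewrite /P1; ring.
Qed.

(** Locally [al r^2 = -2 be r s] and [be s^2 = -2 al r s] modulo [J], so the square of [(r, s)]
    collapses onto multiples of [r s]. As [r^2 s] and [r s^2] are locally in [J], only the value at
    [v] of the coefficient counts. *)
Lemma triple_step ea t g : al \is ea.-homog -> be \is ea.-homog ->
  dr = dss -> (2 * dr <= t)%N -> g \is t.-homog -> loc rs2 g ->
  exists a, loc J (g - a *: (y ^+ (t - 2 * dr) * (r * s))).
Proof.
move=> hal hbe edr let' hg lg; have [l1 l2 l3 l4] := triple_loc.
have idl := loc_ideal v J_ideal; case: (idl) => _ ID IM.
have hG l : sq_gen l \is (2 * dr).-homog.
  have hs : s \is dr.-homog by rewrite edr.
  by rewrite /sq_gen !expr2 mul2n -addnn; case: eqP => _; [|case: eqP => _]; apply: dhomogM.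
have [e [w [H [hw nw hH eH]]]] := loc_gen_homog hG hg lg.
rewrite sum_ord3 /sq_gen /= in eH.
(* The coefficient of [r s] in [al be w g] after both replacements. *)
pose K := al * be * H 1 - (be * be * H 0) *+ 2 - (al * al * H 2%:R) *+ 2.
pose m := (t - 2 * dr)%N.
have hK : K \is (ea + ea + e + m).-homog.
  have hH' l : H l \is (e + m).-homog by have := hH l; rewrite addnBA.
  have hM (x x' : S) l : x \is ea.-homog -> x' \is ea.-homog ->
      x * x' * H l \is (ea + ea + e + m).-homog.
    by move=> hx hx'; rewrite -addnA; apply: dhomogM => //; apply: dhomogM.
  by rewrite !rpredB ?rpredMn // hM.
pose W := al * be * w.
have hW : W \is (ea + ea + e).-homog by rewrite !dhomogM.
have Wv : W.@[v] != 0 by rewrite !mevalM !mulf_neq0.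
exists (K.@[v] / W.@[v]); apply: (loc_cancel Wv).
have [u0 nu0 /pair_genP [a [b eab]]] : loc rs (K - (K.@[v] / W.@[v]) *: (W * y ^+ m)) by apply: loc_rs_quotient hW Wv hK.
have k1 : loc J ((K - (K.@[v] / W.@[v]) *: (W * y ^+ m)) * (r * s)).
  apply: (loc_cancel nu0); rewrite mulrA eab.
  have -> : (a * r + b * s) * (r * s) = a * (r ^+ 2 * s) + b * (r * s ^+ 2) by ring.
  by apply: ID; apply: IM.
have := ID _ _ k1 (ID _ _ (IM (be * H 0) _ l3) (IM (al * H 2%:R) _ l4)); congr loc.
have eW : W * g = al * be * (H 0 * r ^+ 2 + H 1 * (r * s) + H 2%:R * s ^+ 2).
  by rewrite /W -mulrA eH.
rewrite mulrBr eW; move: (K.@[v] / W.@[v]) => c; rewrite -!mul_mpolyC /K -/m; ring.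
Qed.

End Triple.
End Singularities.
End LocalAlgebra.

(** * The Jacobian ideal of a product of conics and its local codimensions *)

Section JacobianIdeal.
Variables (F : fieldType) (f : {mpoly F[3]}).
Local Notation S := {mpoly F[3]}.

Lemma jacobian_idealP g :
  jacobian_ideal f g <-> gen_ideal (fun i : 'I_3 => f^`M(i)) g.
Proof.
by rewrite /jacobian_ideal row_idealP; split=> -[u ->]; exists u;
  apply: eq_bigr => i _; rewrite mxE.
Qed.

Lemma jacobian_is_ideal : is_ideal (jacobian_ideal f).
Proof. exact: row_ideal_is_ideal. Qed.

Lemma jacobian_deriv l : jacobian_ideal f (f^`M(l)).
Proof. by apply/jacobian_idealP; apply: mem_gen_ideal. Qed.

Lemma jacobian_self e : f \is e.-homog -> e%:R != 0 :> F -> jacobian_ideal f f.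
Proof.
move=> hf ne; have [_ _ IM] := jacobian_is_ideal.
rewrite -[X in jacobian_ideal _ X](scalerK ne) -(euler_homog hf) -mul_mpolyC.
apply: (IM); apply: ideal_sum => [|l _]; first exact: jacobian_is_ideal.
exact/IM/jacobian_deriv.
Qed.

Lemma loc_local_at v e t g : f \is e.-homog -> g \is t.-homog ->
  loc v (jacobian_ideal f) g -> local_at v (jacobian_ideal f) g.
Proof.
move=> hf hg [u nu /jacobian_idealP Ju].
have hG (i : 'I_3) : f^`M(i) \is e.-1.-homog by apply: mderiv_homog.
have [|e' [w [H [hw nw _ eH]]]] := loc_gen_homog (v := v) hG hg; first by exists u.
by exists e', w; split=> //; apply/jacobian_idealP; exists H.
Qed.

End JacobianIdeal.

(** Not symmetric: with [c = 0] allowed, the zero vector is proportional to every vector, but not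
    conversely. *)
Definition proportional (F : fieldType) (x y : 'I_3 -> F) := exists c, forall l, x l = c * y l.

Lemma not_proportional_minor (F : fieldType) (x y : 'I_3 -> F) :
  ~ proportional x y -> ~ proportional y x -> exists i k, x i * y k - x k * y i != 0.
Proof.
move=> nxy nyx; apply: boolp.contrapT => h.
have {}h i k : x i * y k = x k * y i.
  by apply/eqP; rewrite -subr_eq0; apply/negPn/negP => n0; apply: h; exists i, k.
have [[k nk]|y0] := boolp.EM (exists k, y k != 0).
  by apply: nxy; exists (x k / y k) => l; rewrite mulrAC -h mulfK.
apply: nyx; exists 0 => l; rewrite mul0r; apply/eqP/negPn/negP => n0; apply: y0.
by exists l.
Qed.

Lemma cards3P (T : finType) (A : {set T}) : #|A| = 3%N ->
  exists a b c, [/\ a != b, a != c, b != c & A = [set a; b; c]].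
Proof.
move=> cA; have /card_gt0P [a aA] : (0 < #|A|)%N by rewrite cA.
have c2 : #|A :\ a| = 2%N by have := cardsD1 a A; rewrite aA cA; lia.
have /cards2P [b [c [nbc e]]] : #|A :\ a| == 2%N by apply/eqP.
exists a, b, c.
have : b \in A :\ a by rewrite e !inE eqxx.
have : c \in A :\ a by rewrite e !inE eqxx orbT.
rewrite !inE ![_ == a]eq_sym => /andP[nac _] /andP[nab _]; split=> //.
by rewrite -(setD1K aA) e setUA.
Qed.

Section Arrangement.
Variables (F : numFieldType) (k : nat) (q : 'I_k -> {mpoly F[3]}) (v : 'I_3 -> F).
Local Notation S := {mpoly F[3]}.
Hypothesis k_gt0 : (0 < k)%N.
Hypothesis q_homog : forall i, q i \is 2.-homog.
Hypothesis v_neq0 : nonzero_vec v.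
Local Notation f := (\prod_(i < k) q i).
Local Notation J := (jacobian_ideal f).

Lemma prod_homog : f \is (2 * k).-homog.
Proof.
have -> : (2 * k = \sum_(i < k) 2)%N by rewrite sum_nat_const card_ord mulnC.
by elim/big_ind2 : _ => [|p a p' a' h h'|i _]; [exact: dhomog1|exact: dhomogM|].
Qed.

Lemma prod_jacobian_self : J f.
Proof.
apply: (jacobian_self prod_homog); rewrite pnatr_eq0 muln_eq0 /=.
by rewrite -lt0n.
Qed.

Lemma distinct_tangents_jac2 i j : distinct_tangents q v -> i != j ->
  i \in through q v -> j \in through q v ->
  exists a b, (jac2 (q i) (q j) a b).@[v] != 0.
Proof.
move=> dt nij hi hj.
have [|//|a [b nab]] := @not_proportional_minor _ (fun l => ((q i)^`M(l)).@[v])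
  (fun l => ((q j)^`M(l)).@[v]).
- exact: dt.
- by apply: dt; rewrite // eq_sym.
by exists a, b; rewrite mevalB !mevalM.
Qed.

Lemma prod_rest_neq0 (A : {set 'I_k}) : through q v \subset A ->
  (\prod_(i | i \notin A) q i).@[v] != 0.
Proof.
move=> sub; rewrite rmorph_prod /=; apply/prodf_neq0 => i nA.
by apply: contra nA => qi0; apply: (subsetP sub); rewrite inE.
Qed.

Lemma node_codim t : node_at q v ->
  exists X : seq (dhomog 3 F t), (size X <= 1)%N /\
    forall x, exists2 y, y \in <<X>>%VS & local_at v J (val (x - y)).
Proof.
move=> [/eqP/cards2P [i [j [nij eA]]] dt]; have [j0 vj0] := v_neq0.
have hi : i \in through q v by rewrite eA !inE eqxx.
have hj : j \in through q v by rewrite eA !inE eqxx orbT.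
have [a [b jab]] := distinct_tangents_jac2 dt nij hi hj.
have qi0 : (q i).@[v] = 0 by apply/eqP; move: hi; rewrite inE.
have qj0 : (q j).@[v] = 0 by apply/eqP; move: hj; rewrite inE.
have ef : f = q i * q j * \prod_(l | l \notin [set i; j]) q l.
  rewrite (bigD1 i) //= (bigD1 j) /=; last by rewrite eq_sym.
  by rewrite mulrA; congr (_ * _); apply: eq_bigl => l; rewrite !inE negb_or.
have hh : (\prod_(l | l \notin [set i; j]) q l).@[v] != 0.
  by apply: prod_rest_neq0; rewrite eA.
pose Y : dhomog 3 F t := DHomog (unit_form_homog v j0 t).
exists [:: Y]; split=> // x; exists ((val x).@[v] *: Y).
  by rewrite memvZ // memv_span // inE.
have hx : val x \is t.-homog by apply: dhomog_is_dhomog.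
apply: (loc_local_at (t := t) prod_homog); first exact: dhomog_is_dhomog.
exact: (node_span vj0 (q_homog i) (q_homog j) qi0 qj0 jab (jacobian_is_ideal f)
  (jacobian_deriv f) hh ef hx).
Qed.

(** The third branch passes through the point, so locally it lies in the ideal of the other two,
    which yields the relation [u q_l = al q_i + be q_j] required by [triple_step]. The bound on [t]
    is the degree of [q i * q j]. *)
Lemma triple_codim t : (4 <= t)%N -> ordinary_triple_at q v ->
  exists X : seq (dhomog 3 F t), (size X <= 4)%N /\
    forall x, exists2 y, y \in <<X>>%VS & local_at v J (val (x - y)).
Proof.
move=> le4 [/cards3P [i [j [l [nij nil njl eA]]]] dt]; have [j0 vj0] := v_neq0.
have hi : i \in through q v by rewrite eA !inE eqxx.
have hj : j \in through q v by rewrite eA !inE eqxx orbT.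
have hl : l \in through q v by rewrite eA !inE eqxx orbT.
have [a [b jab]] := distinct_tangents_jac2 dt nij hi hj.
have qi0 : (q i).@[v] = 0 by apply/eqP; move: hi; rewrite inE.
have qj0 : (q j).@[v] = 0 by apply/eqP; move: hj; rewrite inE.
have ql0 : (q l).@[v] = 0 by apply/eqP; move: hl; rewrite inE.
have ef : f = q i * q j * q l * \prod_(m | m \notin [set i; j; l]) q m.
  rewrite (bigD1 i) //= (bigD1 j) /=; last by rewrite eq_sym.
  rewrite (bigD1 l) /=; last by rewrite ![l == _]eq_sym nil njl.
  rewrite !mulrA; congr (_ * _); apply: eq_bigl => m.
  by rewrite !inE !negb_or.
have hh : (\prod_(m | m \notin [set i; j; l]) q m).@[v] != 0.
  by apply: prod_rest_neq0; rewrite eA.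
have lql := loc_rs_vanish vj0 (q_homog i) (q_homog j) qi0 qj0 jab (q_homog l) ql0.
have hG m : pair_gen (q i) (q j) m \is 2.-homog by rewrite /pair_gen; case: eqP.
have [e [u [H [hu nu hH eH]]]] := loc_gen_homog hG (q_homog l) lql.
rewrite !big_ord_recl big_ord0 addr0 /pair_gen /= in eH.
set al := H ord0 in eH; set be := H (lift _ _) in eH.
(* The gradients at [v] satisfy the same relation; a vanishing [al] or [be] would make two tangents
   coincide. *)
have du m : u.@[v] * ((q l)^`M(m)).@[v] =
    al.@[v] * ((q i)^`M(m)).@[v] + be.@[v] * ((q j)^`M(m)).@[v].
  have := congr1 (fun p => (p^`M(m)).@[v]) eH.
  rewrite !(mderivD, mderivM, mevalD, mevalM) qi0 qj0 ql0 => e1.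
  by move: e1; rewrite !mulr0 !add0r.
have alv : al.@[v] != 0.
  apply/eqP => al0; apply: (dt l j) => //; first by rewrite eq_sym.
  exists (be.@[v] / u.@[v]) => m; apply: (mulfI nu).
  by rewrite du al0 mul0r add0r mulrA mulrCA divff ?mulr1.
have bev : be.@[v] != 0.
  apply/eqP => be0; apply: (dt l i) => //; first by rewrite eq_sym.
  exists (al.@[v] / u.@[v]) => m; apply: (mulfI nu).
  by rewrite du be0 mul0r addr0 mulrA mulrCA divff ?mulr1.
have n3 : 3%:R != 0 :> F by rewrite pnatr_eq0.
pose y := unit_form v j0.
have hy m : y ^+ m \is m.-homog := unit_form_homog v j0 m.
have h1 i' : y ^+ (t - 2) * q i' \is t.-homog.
  by rewrite -[X in X.-homog](subnK (leq_trans (isT : 2 <= 4) le4)%N) dhomogM.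
have h2 : y ^+ (t - 2 * 2) * (q i * q j) \is t.-homog.
  rewrite -[X in X.-homog](subnK le4) dhomogM //; exact: (dhomogM (q_homog i) (q_homog j)).
pose Y0 : dhomog 3 F t := DHomog (hy t).
pose Y1 : dhomog 3 F t := DHomog (h1 i); pose Y2 : dhomog 3 F t := DHomog (h1 j).
pose Y3 : dhomog 3 F t := DHomog h2.
exists [:: Y0; Y1; Y2; Y3]; split=> // x.
have hx : val x \is t.-homog by apply: dhomog_is_dhomog.
pose x0 := val x - (val x).@[v] *: y ^+ t.
have hx0 : x0 \is t.-homog by rewrite rpredB // dhomogZ.
have x0v : x0.@[v] = 0 by rewrite mevalB mevalZ meval_unit_form // mulr1 subrr.
have lx0 := loc_rs_vanish vj0 (q_homog i) (q_homog j) qi0 qj0 jab hx0 x0v.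
have le2 : (2 <= t)%N by apply: leq_trans le4.
have [a1 [a2 lx1]] := loc_rs_step vj0 (q_homog i) (q_homog j) qi0 qj0 jab le2 le2 hx0 lx0.
have [|a3 lx3] := triple_step vj0 (q_homog i) (q_homog j) qi0 qj0 jab (jacobian_is_ideal f)
  (jacobian_deriv f) prod_jacobian_self hh ef eH alv bev n3 (hH ord0) (hH (lift ord0 ord0))
  erefl le4 _ lx1.
  by rewrite rpredB // rpredD // dhomogZ.
exists ((val x).@[v] *: Y0 + (a1 *: Y1 + a2 *: Y2) + a3 *: Y3).
  by rewrite !memvD // memvZ // memv_span // !inE eqxx ?orbT.
apply: (loc_local_at (t := t) prod_homog); first exact: dhomog_is_dhomog.
by move: lx3; congr (loc v _ _); rewrite /= /x0 -/y !opprD !addrA.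
Qed.

End Arrangement.

(** * Intersections of smooth conics *)

Section FivePoints.
Variable F : numFieldType.
Implicit Types (H : 'M[F]_3) (x y : 'rV[F]_3).

Definition bilin H x y : F := (x *m H *m y^T) 0 0.

Lemma bilinDl H x x' y : bilin H (x + x') y = bilin H x y + bilin H x' y.
Proof. by rewrite /bilin !mulmxDl mxE. Qed.

Lemma bilinZl H a x y : bilin H (a *: x) y = a * bilin H x y.
Proof. by rewrite /bilin -!scalemxAl mxE. Qed.

Lemma bilinC H x y : H^T = H -> bilin H x y = bilin H y x.
Proof.
move=> sH; rewrite /bilin -[in RHS]sH.
have -> : y *m H^T *m x^T = (x *m H *m y^T)^T by rewrite !trmx_mul trmxK mulmxA.
by rewrite [RHS]mxE.
Qed.

Lemma bilinDr H x x' y : H^T = H -> bilin H y (x + x') = bilin H y x + bilin H y x'.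
Proof. by move=> sH; rewrite bilinC // bilinDl !(bilinC y). Qed.

Lemma bilinZr H a x y : H^T = H -> bilin H y (a *: x) = a * bilin H y x.
Proof. by move=> sH; rewrite bilinC // bilinZl (bilinC y). Qed.

Lemma bilin0l H y : bilin H 0 y = 0.
Proof. by rewrite /bilin !mul0mx mxE. Qed.

(* A plane that is totally isotropic for a nondegenerate form on [F^3] would be
   contained in its orthogonal, which is a line. *)
Lemma isotropic_bilin_neq0 H x y : H^T = H -> (forall z : 'rV_3, z *m H = 0 -> z = 0) ->
  bilin H x x = 0 -> bilin H y y = 0 ->
  (forall c, x <> c *: y) -> (forall c, y <> c *: x) -> bilin H x y != 0.
Proof.
move=> sH nd xx yy nxy nyx; apply/eqP => xy.
have freeH : row_free H.
  rewrite -kermx_eq0; apply/eqP/row_matrixP => i; rewrite row0.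
  by apply: nd; rewrite -row_mul mulmx_ker row0.
pose X := col_mx x y.
have rX : \rank X = 2%N.
  apply/eqP; change (row_free X); rewrite -kermx_eq0; apply/eqP/row_matrixP => i; rewrite row0.
  have : row i (kermx X) *m X = 0 by rewrite -row_mul mulmx_ker row0.
  set w := row i _; rewrite -[w](@hsubmxK _ 1 1 1) mul_row_col.
  rewrite [lsubmx w]mx11_scalar [rsubmx w]mx11_scalar !mul_scalar_mx.
  set a := lsubmx w 0 0; set b := rsubmx w 0 0 => e.
  have [a0|a0] := eqVneq a 0.
    have [b0|b0] := eqVneq b 0; first by rewrite a0 b0 !raddf0 row_mx0.
    case: (nyx 0); rewrite scale0r; apply: (scalerI b0).
    by rewrite scaler0; move: e; rewrite a0 scale0r add0r.
  case: (nxy (- (a^-1 * b))); rewrite scaleNr -scalerA; apply: (scalerI a0).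
  by rewrite scalerN (scalerKV a0); apply/eqP; rewrite -addr_eq0 e.
have XHX : X *m H *m X^T = 0.
  rewrite mul_col_mx tr_col_mx mul_mx_row !mul_col_mx.
  have z u w : bilin H u w = 0 -> u *m H *m w^T = 0.
    by move=> h; rewrite [LHS]mx11_scalar -/(bilin H u w) h raddf0.
  have yx : bilin H y x = 0 by rewrite bilinC.
  by rewrite !z // col_mx0 row_mx0.
have := mulmx0_rank_max XHX; rewrite mxrankMfree // mxrank_tr rX; lia.
Qed.

(** In the basis formed by the first three points both forms have zero diagonal, so each amounts to
    three off-diagonal values. The other two points impose the same two linear conditions on either
    triple of values, and these are independent because [p4] and [p5] are not proportional. *)
Lemma five_points H H' (p1 p2 p3 p4 p5 : 'rV[F]_3) (s := [:: p1; p2; p3; p4; p5]) :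
  H^T = H -> H'^T = H' -> (forall z : 'rV_3, z *m H = 0 -> z = 0) ->
  (forall x, x \in s -> bilin H x x = 0 /\ bilin H' x x = 0) ->
  (forall i j c, (i < 5)%N -> (j < 5)%N -> i != j -> nth 0 s i <> c *: nth 0 s j) ->
  exists c, H' = c *: H.
Proof.
move=> sH sH' nd iso np.
have nz i j : (i < 5)%N -> (j < 5)%N -> i != j -> bilin H (nth 0 s i) (nth 0 s j) != 0.
  move=> hi hj nij; apply: isotropic_bilin_neq0 => // [||c|c].
  - by case: (iso (nth 0 s i)) => //; apply: mem_nth.
  - by case: (iso (nth 0 s j)) => //; apply: mem_nth.
  - exact: np.
  - by apply: np; rewrite // eq_sym.
have i4 : p4 \in s by rewrite !inE eqxx !orbT.
have i5 : p5 \in s by rewrite !inE eqxx !orbT.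
have [[z1 z1'] [z2 z2'] [z3 z3']] : [/\ bilin H p1 p1 = 0 /\ bilin H' p1 p1 = 0,
    bilin H p2 p2 = 0 /\ bilin H' p2 p2 = 0 & bilin H p3 p3 = 0 /\ bilin H' p3 p3 = 0].
  by split; apply: iso; rewrite !inE eqxx ?orbT.
have b12 : bilin H p1 p2 != 0 := nz 0%N 1%N isT isT isT.
have b13 : bilin H p1 p3 != 0 := nz 0%N 2%N isT isT isT.
have b23 : bilin H p2 p3 != 0 := nz 1%N 2%N isT isT isT.
have b21 : bilin H p2 p1 = bilin H p1 p2 by rewrite bilinC.
have b31 : bilin H p3 p1 = bilin H p1 p3 by rewrite bilinC.
have b32 : bilin H p3 p2 = bilin H p2 p3 by rewrite bilinC.
pose comb (a b c : F) := a *: p1 + b *: p2 + c *: p3.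
(* The Gram matrix of [H] on the three points has zero diagonal, so its determinant is twice the
   product of the off-diagonal values, which is nonzero. *)
have indep a b c : comb a b c = 0 -> [/\ a = 0, b = 0 & c = 0].
  move=> e.
  have e1 : b * bilin H p1 p2 + c * bilin H p1 p3 = 0.
    by rewrite -(bilin0l H p1) -e !bilinDl !bilinZl z1 b21 b31; ring.
  have e2 : a * bilin H p1 p2 + c * bilin H p2 p3 = 0.
    by rewrite -(bilin0l H p2) -e !bilinDl !bilinZl z2 b32; ring.
  have e3 : a * bilin H p1 p3 + b * bilin H p2 p3 = 0.
    by rewrite -(bilin0l H p3) -e !bilinDl !bilinZl z3; ring.
  have c0 : c = 0.
    have : 2%:R * (bilin H p1 p3 * bilin H p2 p3) * c = 0.
      transitivity (bilin H p1 p3 * (a * bilin H p1 p2 + c * bilin H p2 p3)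
        + bilin H p2 p3 * (b * bilin H p1 p2 + c * bilin H p1 p3)
        - bilin H p1 p2 * (a * bilin H p1 p3 + b * bilin H p2 p3)); first by ring.
      by rewrite e1 e2 e3; ring.
    by move=> /eqP; rewrite !mulf_eq0 pnatr_eq0 (negPf b13) (negPf b23) => /eqP.
  move: e1 e2; rewrite c0 !mul0r !addr0 => /eqP e1 /eqP e2; split=> //; apply/eqP.
    by move: e2; rewrite mulf_eq0 (negPf b12) orbF.
  by move: e1; rewrite mulf_eq0 (negPf b12) orbF.
pose P : 'M[F]_3 := \matrix_(i < 3) (if i == 0 then p1 else if i == 1 then p2 else p3).
have combP a b c : comb a b c = (\row_i (if i == 0 then a else if i == 1 then b else c)) *m P.
  apply/rowP => l; rewrite !mxE sum_ord3 !mxE /=; by [].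
have Pu : P \in unitmx.
  rewrite -row_free_unit -kermx_eq0; apply/eqP/row_matrixP => i; rewrite row0.
  have : row i (kermx P) *m P = 0 by rewrite -row_mul mulmx_ker row0.
  move: (row i _) => w e.
  have ew : w = \row_i (if i == 0 then w 0 0 else if i == 1 then w 0 1 else w 0 2%:R).
    by apply/rowP => -[[|[|[|//]]] h]; rewrite [RHS]mxE /=; congr (w _ _); apply/val_inj.
  have [|c1 c2 c3] := indep (w 0 0) (w 0 1) (w 0 2%:R); first by rewrite combP -ew.
  by rewrite ew c1 c2 c3; apply/rowP => l; rewrite !mxE !if_same.
have dec x : exists a b c, x = comb a b c.
  pose w := x *m invmx P; exists (w 0 0), (w 0 1), (w 0 2%:R); rewrite combP.
  rewrite -[LHS](mulmxKV Pu) -/w; congr (_ *m _).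
  by apply/rowP => -[[|[|[|//]]] h]; rewrite [RHS]mxE /=; congr (w _ _); apply/val_inj.
have quad K a b c : K^T = K -> bilin K p1 p1 = 0 -> bilin K p2 p2 = 0 -> bilin K p3 p3 = 0 ->
    bilin K (comb a b c) (comb a b c) =
    2%:R * (a * b * bilin K p1 p2 + a * c * bilin K p1 p3 + b * c * bilin K p2 p3).
  move=> sK k1 k2 k3; rewrite !(bilinDl, bilinZl) !(bilinDr _ _ _ sK, bilinZr _ _ _ sK) k1 k2 k3.
  by rewrite (bilinC p2 p1) // (bilinC p3 p1) // (bilinC p3 p2) //; ring.
have coef x : x \in s -> exists a b c, [/\ x = comb a b c,
    a * b * bilin H p1 p2 + a * c * bilin H p1 p3 + b * c * bilin H p2 p3 = 0 &
    a * b * bilin H' p1 p2 + a * c * bilin H' p1 p3 + b * c * bilin H' p2 p3 = 0].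
  move=> /iso [h h']; have [a [b [c e]]] := dec x; exists a, b, c.
  have n2 : 2%:R != 0 :> F by rewrite pnatr_eq0.
  by move: h h'; rewrite e !quad // => /eqP h /eqP h'; split=> //; apply/eqP;
    move: h h'; rewrite !mulf_eq0 (negPf n2).
(* A smooth conic through the vertices of the coordinate triangle meets each side only in vertices,
   so its other points have no zero coordinate. *)
have nzc x a b c : x = comb a b c -> (forall d, x <> d *: p1) -> (forall d, x <> d *: p2) ->
    (forall d, x <> d *: p3) ->
    a * b * bilin H p1 p2 + a * c * bilin H p1 p3 + b * c * bilin H p2 p3 = 0 ->
    [/\ a != 0, b != 0 & c != 0].
  move=> ex n1 n2 n3 e.
  have abc : [/\ ~ (a = 0 /\ b = 0), ~ (a = 0 /\ c = 0) & ~ (b = 0 /\ c = 0)].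
    split=> -[u0 w0]; [case: (n3 c)|case: (n2 b)|case: (n1 a)];
      by rewrite ex /comb u0 w0 !scale0r ?add0r ?addr0.
  case: abc => ab ac bc; split; apply/eqP => u0; move: e; rewrite u0.
  - rewrite !mul0r !add0r => /eqP; rewrite !mulf_eq0 (negPf b23) orbF => /orP[]/eqP w0.
      exact: ab.
    exact: ac.
  - rewrite !(mulr0, mul0r) add0r addr0 => /eqP; rewrite !mulf_eq0 (negPf b13) orbF => /orP[]/eqP w0.
      exact: ab.
    exact: bc.
  - rewrite !(mulr0, mul0r) !addr0 => /eqP; rewrite !mulf_eq0 (negPf b12) orbF => /orP[]/eqP w0.
      exact: ac.
    exact: bc.
have [s1 [s2 [s3 [es hs hs']]]] := coef p4 i4.
have [t1 [t2 [t3 [et ht ht']]]] := coef p5 i5.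
have [||| s1n s2n s3n] := nzc _ _ _ _ es _ _ _ hs.
- by move=> d; apply: (np 3%N 0%N d).
- by move=> d; apply: (np 3%N 1%N d).
- by move=> d; apply: (np 3%N 2%N d).
have [||| t1n t2n t3n] := nzc _ _ _ _ et _ _ _ ht.
- by move=> d; apply: (np 4%N 0%N d).
- by move=> d; apply: (np 4%N 1%N d).
- by move=> d; apply: (np 4%N 2%N d).
(* The pair [p1, p2] fixes the scale; [D13] and [D23] measure the failure on the other two pairs. *)
pose c := bilin H' p1 p2 / bilin H p1 p2.
have ec : bilin H' p1 p2 = c * bilin H p1 p2 by rewrite /c divfK.
pose D13 := bilin H' p1 p3 - c * bilin H p1 p3.
pose D23 := bilin H' p2 p3 - c * bilin H p2 p3.
have lin a b d : d != 0 ->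
    a * b * bilin H p1 p2 + a * d * bilin H p1 p3 + b * d * bilin H p2 p3 = 0 ->
    a * b * bilin H' p1 p2 + a * d * bilin H' p1 p3 + b * d * bilin H' p2 p3 = 0 ->
    a * D13 + b * D23 = 0.
  move=> nd0 h h'; apply: (mulfI nd0); rewrite mulr0.
  transitivity ((a * b * bilin H' p1 p2 + a * d * bilin H' p1 p3 + b * d * bilin H' p2 p3)
    - c * (a * b * bilin H p1 p2 + a * d * bilin H p1 p3 + b * d * bilin H p2 p3)).
    by rewrite ec /D13 /D23; ring.
  by rewrite h h' mulr0 subrr.
have ls := lin _ _ _ s3n hs hs'; have lt := lin _ _ _ t3n ht ht'.
(* Otherwise [(t1 : t2) = (s1 : s2)], so [p5] is on the line through [p3] and [p4]. This line meets
   the conic of [H] in one point besides [p3], making [p5] a multiple of [p4]. *)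
have D0 : D13 = 0.
  apply/eqP/negPn/negP => nD.
  have st : t1 * s2 = t2 * s1.
    apply: (mulIf nD); transitivity (s2 * (t1 * D13 + t2 * D23) - t2 * (s1 * D13 + s2 * D23) + t2 * s1 * D13); first by ring.
    by rewrite ls lt; ring.
  pose la := t1 / s1; have e1 : t1 = la * s1 by rewrite /la divfK.
  have e2 : t2 = la * s2.
    by apply: (mulIf s1n); rewrite -st e1; ring.
  have lan : la != 0 by rewrite /la mulf_neq0 ?invr_eq0.
  pose E := s1 * bilin H p1 p3 + s2 * bilin H p2 p3.
  have En : E != 0.
    apply/eqP => E0; have : s1 * s2 * bilin H p1 p2 = 0.
      by rewrite -[RHS]hs; transitivity (s1 * s2 * bilin H p1 p2 + s3 * E);
        [rewrite E0; ring|rewrite /E; ring].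
    by move=> /eqP; rewrite !mulf_eq0 (negPf s1n) (negPf s2n) (negPf b12).
  have e3 : t3 = la * s3.
    apply: (mulIf (mulf_neq0 lan En)); apply/eqP; rewrite -subr_eq0; apply/eqP.
    transitivity ((t1 * t2 * bilin H p1 p2 + t1 * t3 * bilin H p1 p3 + t2 * t3 * bilin H p2 p3)
      - la ^+ 2 * (s1 * s2 * bilin H p1 p2 + s1 * s3 * bilin H p1 p3 + s2 * s3 * bilin H p2 p3)).
      by rewrite e1 e2 /E; ring.
    by rewrite ht hs mulr0 subrr.
  by apply: (np 4%N 3%N la) => //=; rewrite et es e1 e2 e3 /comb !scalerDr !scalerA.
have D0' : D23 = 0.
  by move: ls; rewrite D0 mulr0 add0r => /eqP; rewrite mulf_eq0 (negPf s2n) => /eqP.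
exists c; apply/eqP; rewrite -subr_eq0; apply/eqP; pose K := H' - c *: H.
have sK : K^T = K by rewrite /K linearB linearZ /= sH sH'.
have bK x y : bilin K x y = bilin H' x y - c * bilin H x y.
  by rewrite /bilin /K mulmxBr mulmxBl -scalemxAr -scalemxAl !mxE.
have k12 : bilin K p1 p2 = 0 by rewrite bK ec subrr.
have k13 : bilin K p1 p3 = 0 by rewrite bK.
have k23 : bilin K p2 p3 = 0 by rewrite bK.
have kd : [/\ bilin K p1 p1 = 0, bilin K p2 p2 = 0 & bilin K p3 p3 = 0].
  by rewrite !bK z1 z2 z3 z1' z2' z3' mulr0 subrr.
case: kd => k1 k2 k3.
have allK x y : bilin K x y = 0.
  have [a [b [d ->]]] := dec x; have [a' [b' [d' ->]]] := dec y.
  rewrite /comb !(bilinDl, bilinZl) !(bilinDr _ _ _ sK, bilinZr _ _ _ sK).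
  rewrite (bilinC p2 p1 sK) (bilinC p3 p1 sK) (bilinC p3 p2 sK) k1 k2 k3 k12 k13 k23; ring.
apply/matrixP => i j; rewrite [RHS]mxE -(allK (delta_mx 0 i) (delta_mx 0 j)).
by rewrite /bilin -rowE trmx_delta -colE !mxE.
Qed.

End FivePoints.

Section Conics.
Variable F : numFieldType.
Implicit Types (q : {mpoly F[3]}) (x : 'I_3 -> F).

(** Second derivatives of a quadratic form are constants; evaluation at the origin reads them as
    scalars. *)
Definition hess q : 'M[F]_3 := \matrix_(l, m) ((q^`M(l))^`M(m)).@[fun=> 0].

Lemma hess_sym q : (hess q)^T = hess q.
Proof. by apply/matrixP => l m; rewrite !mxE mderiv_comm. Qed.

Lemma homog0_const (p : {mpoly F[3]}) : p \is 0.-homog -> p = (p.@[fun=> 0])%:MP.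
Proof.
move=> hp; have e : p = (p@_0%MM)%:MP.
  apply/mpolyP => m; rewrite mcoeffC; case: (eqVneq 0%MM m) => [<-|nm]; first by rewrite mulr1.
  by rewrite mulr0 (dhomog_nemf_coeff hp) // mdeg_eq0 eq_sym.
by rewrite {2}e mevalC.
Qed.

Lemma deriv_hess q l : q \is 2.-homog -> q^`M(l) = \sum_m 'X_m * (hess q l m)%:MP.
Proof.
move=> hq; have hl : q^`M(l) \is 1.-homog := mderiv_homog l hq.
rewrite -[LHS]scale1r -(euler_homog hl); apply: eq_bigr => m _; rewrite mxE -homog0_const //.
exact: (mderiv_homog m hl).
Qed.

Lemma double_hess q : q \is 2.-homog ->
  2%:R *: q = \sum_l 'X_l * \sum_m 'X_m * (hess q l m)%:MP.
Proof. by move=> hq; rewrite -(euler_homog hq); apply: eq_bigr => l _; rewrite deriv_hess. Qed.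

Lemma meval_deriv_hess q l x : q \is 2.-homog ->
  (q^`M(l)).@[x] = ((\row_i x i) *m hess q) 0 l.
Proof.
move=> hq; rewrite deriv_hess // raddf_sum mxE; apply: eq_bigr => m _ /=.
by rewrite mevalM mevalXU mevalC mxE -[in RHS]hess_sym [in RHS]mxE.
Qed.

Lemma meval_bilin q x : q \is 2.-homog -> 2%:R * q.@[x] = bilin (hess q) (\row_i x i) (\row_i x i).
Proof.
move=> hq; rewrite -mevalZ -(euler_homog hq) raddf_sum /bilin mxE; apply: eq_bigr => l _ /=.
by rewrite mevalM mevalXU meval_deriv_hess // mulrC; congr (_ * _); rewrite !mxE.
Qed.

Lemma bilin_hess0 q x : q \is 2.-homog -> q.@[x] = 0 -> bilin (hess q) (\row_i x i) (\row_i x i) = 0.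
Proof. by move=> hq h; rewrite -meval_bilin // h mulr0. Qed.

(** A kernel vector is a common zero of the partial derivatives and, by Euler's formula, of [q]
    itself. *)
Lemma hess_nondegenerate q : q \is 2.-homog -> smooth_curve q ->
  forall z : 'rV[F]_3, z *m hess q = 0 -> z = 0.
Proof.
move=> hq sm z hz; apply/eqP/negPn/negP => nz.
have ez : z = \row_i z 0 i by apply/rowP => i; rewrite mxE.
have nv : nonzero_vec (fun i => z 0 i).
  apply: boolp.contrapT => h; case/eqP: nz; apply/rowP => i; rewrite [RHS]mxE.
  by apply/eqP/negPn/negP => ni; apply: h; exists i.
have dz l : (q^`M(l)).@[fun i => z 0 i] = 0 by rewrite meval_deriv_hess // -ez hz mxE.
have [|l] := sm _ nv; last by rewrite dz eqxx.
have := meval_bilin (fun i => z 0 i) hq; rewrite /bilin -ez hz mul0mx mxE => /eqP.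
by rewrite mulf_eq0 pnatr_eq0 => /eqP.
Qed.

Lemma hess_inj q q' c : q \is 2.-homog -> q' \is 2.-homog -> hess q' = c *: hess q -> q' = c *: q.
Proof.
move=> hq hq' e; have n2 : 2%:R != 0 :> F by rewrite pnatr_eq0.
apply: (scalerI n2); rewrite scalerA mulrC -scalerA !double_hess // scaler_sumr.
apply: eq_bigr => l _; rewrite scalerAr scaler_sumr; congr (_ * _); apply: eq_bigr => m _.
by rewrite e mxE scalerAr mpolyCM mul_mpolyC.
Qed.

Lemma card_conic_intersection m (p : 'I_m -> 'I_3 -> F) q q' :
  (forall a b, a != b -> ~ proportional (p a) (p b)) ->
  q \is 2.-homog -> q' \is 2.-homog -> smooth_curve q -> (forall c, q' != c *: q) ->
  (#|[set a | (q.@[p a] == 0%R) && (q'.@[p a] == 0%R)]| <= 4)%N.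
Proof.
move=> np hq hq' sm nq; rewrite leqNgt; apply/negP; set A := [set a | _] => cA.
have [a0 a0A] : exists a, a \in A by apply/card_gt0P; apply: leq_trans cA.
pose e i := nth a0 (enum A) i; pose pt i : 'rV[F]_3 := \row_l p (e i) l.
have eA i : (i < 5)%N -> e i \in A.
  by move=> hi; rewrite -mem_enum mem_nth // -cardE (leq_trans hi).
have ptE i : (i < 5)%N -> nth 0 [seq pt i | i <- iota 0 5] i = pt i.
  by move=> hi; rewrite (nth_map 0%N) ?size_iota // nth_iota.
have [||c e1] := @five_points F (hess q) (hess q') (pt 0%N) (pt 1%N) (pt 2%N) (pt 3%N) (pt 4%N)
  (hess_sym q) (hess_sym q') (hess_nondegenerate hq sm).
- have bpt i : (i < 5)%N ->
      bilin (hess q) (pt i) (pt i) = 0 /\ bilin (hess q') (pt i) (pt i) = 0.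
    by move=> /eA; rewrite inE => /andP[/eqP h /eqP h']; split; apply: bilin_hess0.
  by move=> x; rewrite !inE => /orP[|/orP[|/orP[|/orP[]]]] /eqP ->; apply: bpt.
- move=> i j c hi hj nij; change (nth 0 [seq pt i | i <- iota 0 5] i <>
    c *: nth 0 [seq pt i | i <- iota 0 5] j); rewrite !ptE // => /rowP h.
  apply: (np (e i) (e j)).
    by rewrite nth_uniq ?enum_uniq // -cardE ?(leq_trans hi) ?(leq_trans hj).
  by exists c => l; have := h l; rewrite !mxE.
by case/eqP: (nq c); apply: hess_inj.
Qed.

End Conics.

(** * Incidences between the conics and the singular points *)

Section Counting.
Variables (F : numFieldType) (k : nat) (q : 'I_k -> {mpoly F[3]}).
Hypothesis q_homog : forall i, q i \is 2.-homog.
Hypothesis q_smooth : forall i, smooth_curve (q i).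
Hypothesis q_neq : forall i j c, i != j -> q i != c *: q j.

(** The left side counts ordered pairs of distinct conics together with a common point among the
    [p a]; each of the [k(k-1)] pairs has at most four such points. *)
Lemma sum_through_le m (p : 'I_m -> 'I_3 -> F) :
  (forall a b, a != b -> ~ proportional (p a) (p b)) ->
  (\sum_a #|through q (p a)| * #|through q (p a)|.-1 <= 4 * (k * k.-1))%N.
Proof.
move=> np.
have E a : (#|through q (p a)| * #|through q (p a)|.-1 =
    \sum_(i < k) \sum_(j < k | j != i) ((i \in through q (p a)) && (j \in through q (p a))))%N.
  rewrite -sum_nat_const big_mkcond /=; apply: eq_bigr => i _.
  case: ifP => hi; last by rewrite big1.
  transitivity (\sum_(j in through q (p a) :\ i) 1)%N.
    by rewrite sum1_card (cardsD1 i) hi.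
  rewrite big_mkcond [RHS]big_mkcond; apply: eq_bigr => j _; rewrite in_setD1.
  by case: (j == i) (j \in _) => [] [].
rewrite (eq_bigr _ (fun a _ => E a)) exchange_big /=.
have -> : (4 * (k * k.-1) = \sum_(i < k) \sum_(j < k | j != i) 4)%N.
  under eq_bigr => i _ do rewrite sum_nat_const cardC1 card_ord.
  by rewrite sum_nat_const card_ord mulnC mulnA.
apply: leq_sum => i _; rewrite exchange_big /=; apply: leq_sum => j nji.
have := card_conic_intersection np (q_homog i) (q_homog j) (@q_smooth i) (fun c => q_neq c nji).
apply: leq_trans; rewrite -sum1_card big_mkcond [X in (_ <= X)%N]big_mkcond /=.
by apply: leq_sum => a _; rewrite !inE; case: (_ && _).
Qed.

Hypothesis sing : forall v, singular_point (\prod_(i < k) q i) v ->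
  node_at q v \/ ordinary_triple_at q v.

Definition codim_weight (v : 'I_3 -> F) := if #|through q v| == 2%N then 1%N else 4%N.

(** The comparison is 3 against 4 at a node and 12 against 12 at a triple point. *)
Lemma codim_weight_le v : singular_point (\prod_(i < k) q i) v ->
  (3 * codim_weight v <= 2 * (#|through q v| * #|through q v|.-1))%N.
Proof. by rewrite /codim_weight => /sing [] [-> _]. Qed.

(** Every singular point lies on at least two of the conics, so the incidence count bounds the size
    of a family of pairwise non-proportional ones. A family that cannot be enlarged represents them
    all. *)
Lemma singular_representatives : exists m (p : 'I_m -> 'I_3 -> F),
  [/\ (forall a, singular_point (\prod_(i < k) q i) (p a)),
      (forall a b, a != b -> ~ proportional (p a) (p b)) &
      forall v, singular_point (\prod_(i < k) q i) v ->
        exists a c, c != 0 /\ v =1 (fun l => c * p a l)].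
Proof.
pose E m := exists p : 'I_m -> 'I_3 -> F, (forall a, singular_point (\prod_(i < k) q i) (p a)) /\
  (forall a b, a != b -> ~ proportional (p a) (p b)).
have bound m : E m -> (m <= 4 * (k * k.-1))%N.
  move=> [p [sp np]]; apply: leq_trans (sum_through_le np).
  rewrite -{1}(card_ord m) -sum1_card; apply: leq_sum => a _.
  by have [[-> _]|[-> _]] := sing (sp a).
have [m [Em nEm]] : exists m, E m /\ ~ E m.+1.
  apply: boolp.contrapT => h.
  have all m : E m.
    elim: m => [|m IH]; first by exists (fun=> fun=> 0); split=> -[].
    by apply: boolp.contrapT => n; apply: h; exists m.
  by have := bound _ (all (4 * (k * k.-1)).+1); rewrite ltnn.
have [p [sp np]] := Em; exists m, p; split=> // v sv.
(* A proportionality factor may be zero in general; it is invertible when the left vector is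
   nonzero. *)
have inv (x y : 'I_3 -> F) : nonzero_vec x -> proportional x y ->
    exists c, c != 0 /\ x =1 (fun l => c * y l).
  move=> [l nl] [c h]; exists c; split=> //.
  by apply: contraNneq nl => c0; rewrite h c0 mul0r.
apply: boolp.contrapT => nv; apply: nEm.
exists (fun a => if unlift ord0 a is Some b then p b else v); split.
  by move=> a; case: unliftP.
move=> a b; case: unliftP => [a' ->|->]; case: unliftP => [b' ->|->].
- by rewrite (inj_eq lift_inj); apply: np.
- move=> _ /(inv _ _ (proj1 (sp a'))) [c [nc h]]; apply: nv; exists a', c^-1.
  by rewrite invr_eq0; split=> // l; rewrite h mulKf.
- by move=> _ /(inv _ _ (proj1 sv)) [c h]; apply: nv; exists b', c.
- by rewrite eqxx.
Qed.

End Counting.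

(** Characteristic zero enters through Euler's formula and the cancellation of 2 and 3, algebraic
    closure through the splitting of binary forms. *)
Lemma conic_arrangement_not_nearly_free (F : numClosedFieldType) k (q : 'I_k -> {mpoly F[3]}) :
  (2 <= k)%N ->
  (forall i, q i \is 2.-homog) ->
  (forall i, smooth_curve (q i)) ->
  (forall (i j : 'I_k) (c : F), i != j -> q i != c *: q j) ->
  (forall v : 'I_3 -> F, singular_point (\prod_(i < k) q i) v ->
     node_at q v \/ ordinary_triple_at q v) ->
  ~ nearly_free (\prod_(i < k) q i).
Proof.
move=> k2 hq sm nq sing nf; have k0 : (0 < k)%N by apply: leq_trans k2.
have [T [c [hc hW hsoc]]] := nearly_free_hilbert (prod_homog hq) nf.
have [m [p [sp np all]]] := singular_representatives hq sm nq sing.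
have : (c <= \sum_a codim_weight q (p a))%N.
  apply: (@local_codim_bound F _ T c (jacobian_is_ideal _) hW hsoc m p _ 4).
    move=> v j vj hv; apply: all; split; first by exists j; rewrite vj oner_eq0.
    by move=> l; apply: hv (mderiv_homog l (prod_homog hq)) (jacobian_deriv _ l).
  move=> a t le4; rewrite /codim_weight; have [nz _] := sp a.
  have [h|h] := sing _ (sp a); rewrite (proj1 h) /=.
    exact: node_codim.
  exact: triple_codim.
have h3 : (3 * \sum_a codim_weight q (p a) <=
    2 * \sum_a #|through q (p a)| * #|through q (p a)|.-1)%N.
  by rewrite !big_distrr /=; apply: leq_sum => a _; apply: codim_weight_le.
have := sum_through_le hq sm nq np; have : (0 < k * k.-1)%N by rewrite muln_gt0 k0 -subn1 subn_gt0.
move: hc h3; move: (k * k.-1)%N (\sum_a codim_weight _ _)%N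
  (\sum_a #|through q (p a)| * #|through q (p a)|.-1)%N => x w z; lia.
Qed.

Theorem theorem2p1 (R : realType) (k : nat) (q : 'I_k -> {mpoly R[i][3]}) :
  (2 <= k)%N ->
  (forall i, q i \is 2.-homog) ->
  (forall i, smooth_curve (q i)) ->
  (forall (i j : 'I_k) (c : R[i]), i != j -> q i != c *: q j) ->
  (forall v : 'I_3 -> R[i], singular_point (\prod_(i < k) q i) v ->
     node_at q v \/ ordinary_triple_at q v) ->
  ~ nearly_free (\prod_(i < k) q i).
Proof. exact: conic_arrangement_not_nearly_free. Qed.
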